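(* Let $0<p<1$, let $\overline{X}$ be a $p$-convex quasi-Banach lattice couple, and let $X$ be a $K$-monotone quasi-Banach lattice with respect to $\overline{X}$. Then $X$ is $K(p,q)$-monotone with respect to $\overline{X}$ for some $q\in(0,p]$, and hence $X\in Int^{K}(\overline{X})$. Moreover, $$Int^{KM}(\overline{X})=Int^{K}(\overline{X})=\bigcup_{0<q\le r\le 1}Int^{KM}_{(r,q)}(\overline{X}).$$
   Context: All spaces are real. A quasi-Banach lattice is a vector lattice with a complete quasi-norm such that $\|x\|\le\|y\|$ whenever $|x|\le|y|$. It is $p$-convex if for some $M$ and all finite families $\|(\sum|x_k|^p)^{1/p}\|\le M(\sum\|x_k\|^p)^{1/p}$ (the expression on the left being defined by the homogeneous functional calculus). A quasi-Banach lattice couple $\overline{X}=(X_0,X_1)$ is a pair of quasi-Banach lattices both embedded into some Hausdorff topological vector lattice by continuous, interval preserving, injective lattice homomorphisms; it is $p$-convex if both $X_0,X_1$ are. $\Delta(\overline X)=X_0\cap X_1$ with quasi-norm $\max(\|x\|_{X_0},\|x\|_{X_1})$; $\Sigma(\overline X)=X_0+X_1$ with quasi-norm $\inf\{\|x_0\|_{X_0}+\|x_1\|_{X_1}:x=x_0+x_1\}$. $K(t,x;\overline{X})=\inf\{\|x_0\|_{X_0}+t\|x_1\|_{X_1}:x=x_0+x_1,\ x_i\in X_i\}$. A quasi-Banach lattice $X$ is intermediate if $\Delta(\overline X)\subset X\subset\Sigma(\overline X)$, the inclusions being continuous interval preserving lattice homomorphisms. For a lattice couple, the collections below consist of intermediate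 quasi-Banach lattices (spaces identified up to equivalence of quasi-norms). An intermediate $X$ is $K$-monotone with respect to $\overline X$ if $x\in X$, $y\in\Sigma(\overline X)$ and $K(t,y;\overline X)\le K(t,x;\overline X)$ for all $t>0$ imply $y\in X$; it is uniformly $K$-monotone if moreover $\|y\|_X\le C\|x\|_X$ with $C$ independent of $x,y$. $Int^{KM}(\overline X)$ is the collection of uniformly $K$-monotone spaces. For $0<q\le p\le1$, $X$ is $K(p,q)$-monotone with respect to $\overline X$ if there is $C>0$ such that whenever $\sum_{i=1}^\infty\|x_i\|_X^q<\infty$ ($x_i\in X$), $x\in\Sigma(\overline X)$ and $K(t,x;\overline X)\le(\sum_{i=1}^\infty K(t,x_i;\overline X)^p)^{1/p}$ for all $t>0$, one has $x\in X$ and $\|x\|_X\le C(\sum_i\|x_i\|_X^q)^{1/q}$. $Int^{KM}_{(p,q)}(\overline X)$ is the collection of such spaces. $\overline{L^\infty}=(L^\infty,L^\infty(1/t))$ is the couple of spaces on $(0,\infty)$ (Lebesgue measure) with norms $\operatorname{ess\,sup}|f(t)|$ and $\operatorname{ess\,sup}|f(t)|/t$. For a quasi-Banach function lattice $E$ on $(0,\infty)$ intermediate with respect to $\overline{L^\infty}$ (without loss of generality an interpolation space for $\overline{L^\infty}$), $\overline{X}_{E:K}$ is the space of $x\in\Sigma(\overline X)$ with $\|x\|=\|K(\cdot,x;\overline X)\|_E<\infty$; $Int^K(\overline X)$ is the collection of all such spaces. *)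

(* Defs.v *)
From HB Require Import structures.
From mathcomp Require Import all_boot all_order all_algebra.
From mathcomp Require Import all_classical all_reals all_analysis.
Set Implicit Arguments.
Unset Strict Implicit.
Unset Printing Implicit Defensive.
Import Order.TTheory GRing.Theory Num.Theory.
Import numFieldNormedType.Exports.
Local Open Scope classical_set_scope.
Local Open Scope ring_scope.

(* The library's lattice structures cannot be joined with its modules, so the
   lattice operations are added on top of the partial order. *)
HB.mixin Record POrderedLmodule_isVectorLattice (R : numDomainType) V
    & GRing.Lmodule R V & Num.POrderedZmodule V := {
  vjoin : V -> V -> V ;
  vmeet : V -> V -> V ;
  vjoin_lub : forall x y z : V, (vjoin x y <= z) = (x <= z) && (y <= z) ;
  vmeet_glb : forall x y z : V, (z <= vmeet x y) = (z <= x) && (z <= y) ;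
  vlattice_leD2r : forall x y z : V, x <= y -> x + z <= y + z ;
  vlattice_scale_ge0 : forall (a : R) (x : V), 0 <= a -> 0 <= x -> 0 <= a *: x ;
}.

#[short(type="vectorLatticeType")]
HB.structure Definition VectorLattice (R : numDomainType) :=
  {V of GRing.Lmodule R V & Num.POrderedZmodule V
      & POrderedLmodule_isVectorLattice R V}.

Definition vabs (R : numDomainType) (V : vectorLatticeType R) (x : V) : V :=
  vjoin x (- x).

Definition solid (R : numDomainType) (V : vectorLatticeType R) (U : set V) :=
  forall x y : V, vabs x <= vabs y -> U y -> U x.

(* A topological vector lattice is a vector lattice with a vector topology (not
   assumed locally convex) in which the solid neighbourhoods of 0 form a base
   at 0. *)
HB.mixin Record TopologicalLmodule_isLocallySolid (R : numDomainType) V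
    & TopologicalLmodule R V & VectorLattice R V := {
  locally_solid : forall U : set V, nbhs 0 U ->
    exists W : set V, [/\ nbhs 0 W, solid W & W `<=` U] ;
}.

#[short(type="topVectorLatticeType")]
HB.structure Definition TopVectorLattice (R : numDomainType) :=
  {V of TopologicalLmodule R V & VectorLattice R V
      & TopologicalLmodule_isLocallySolid R V}.

HB.mixin Record VectorLattice_isQuasiBanach (R : realType) X
    & VectorLattice R X := {
  qnorm : X -> R ;
  qnorm_ge0 : forall x, 0 <= qnorm x ;
  qnorm0_eq0 : forall x, qnorm x = 0 -> x = 0 ;
  qnormZ : forall (a : R) (x : X), qnorm (a *: x) = `|a| * qnorm x ;
  qnormD : exists C : R, forall x y, qnorm (x + y) <= C * (qnorm x + qnorm y) ;
  le_qnorm : forall x y : X, vabs x <= vabs y -> qnorm x <= qnorm y ;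
  qnorm_complete : forall u : nat -> X,
    (forall e : R, 0 < e -> exists N : nat, forall m n : nat,
       (N <= m)%N -> (N <= n)%N -> qnorm (u m - u n) < e) ->
    exists l : X, forall e : R, 0 < e -> exists N : nat, forall n : nat,
       (N <= n)%N -> qnorm (u n - l) < e ;
}.

#[short(type="quasiBanachLatticeType")]
HB.structure Definition QuasiBanachLattice (R : realType) :=
  {X of VectorLattice R X & VectorLattice_isQuasiBanach R X}.

Definition lattice_hom (R : numDomainType) (U V : vectorLatticeType R)
    (f : U -> V) :=
  (forall x y, f (vjoin x y) = vjoin (f x) (f y)) /\
  (forall x y, f (vmeet x y) = vmeet (f x) (f y)).

Definition interval_preserving (R : numDomainType) (U V : vectorLatticeType R)
    (f : U -> V) :=
  forall x : U, 0 <= x ->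
    f @` [set y | 0 <= y <= x] = [set z | 0 <= z <= f x].

Definition qnorm_continuous (R : realType) (X : quasiBanachLatticeType R)
    (V : topologicalType) (f : X -> V) :=
  forall (x : X) (U : set V), nbhs (f x) U ->
    exists2 d : R, 0 < d & forall y, qnorm (y - x) < d -> U (f y).

Definition homogeneous_continuous (R : realType) (n : nat)
    (h : 'rV[R]_n -> R) :=
  continuous h /\ forall (a : R) s, 0 <= a -> h (a *: s) = a * h s.

(* The functional calculus of a family x is the lattice homomorphism from the
   continuous positively homogeneous functions on R^n to X which sends the i-th
   coordinate function to x i.  It exists and is unique in every quasi-Banach
   lattice; only the values of tau on such functions are relevant. *)
Record functional_calculus (R : realType) (X : quasiBanachLatticeType R)
    (n : nat) (x : 'I_n -> X) (tau : ('rV[R]_n -> R) -> X) : Prop := {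
  fcalc_linear : forall (a : R) h g,
    homogeneous_continuous h -> homogeneous_continuous g ->
    tau (fun s => a * h s + g s) = a *: tau h + tau g ;
  fcalc_join : forall h g,
    homogeneous_continuous h -> homogeneous_continuous g ->
    tau (fun s => Num.max (h s) (g s)) = vjoin (tau h) (tau g) ;
  fcalc_meet : forall h g,
    homogeneous_continuous h -> homogeneous_continuous g ->
    tau (fun s => Num.min (h s) (g s)) = vmeet (tau h) (tau g) ;
  fcalc_coord : forall i, tau (fun s => s 0 i) = x i ;
}.

Definition p_convex (R : realType) (p : R) (X : quasiBanachLatticeType R) :=
  exists M : R, forall (n : nat) (x : 'I_n -> X),
    exists2 tau, functional_calculus x tau &
      qnorm (tau (fun s => (\sum_(i < n) `|s 0 i| `^ p) `^ p^-1))
        <= M * (\sum_(i < n) qnorm (x i) `^ p) `^ p^-1.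

(* Spaces living in a common ambient space V; nrm is meaningful on dom only. *)
Record nspace (R : realType) (V : Type) := NSpace {
  dom : set V ;
  nrm : V -> R ;
}.

Definition image_space (R : realType) (X : quasiBanachLatticeType R)
    (V : Type) (j : X -> V) : nspace R V :=
  NSpace (range j) (fun v => qnorm (xget 0 [set x | j x = v])).

Section Nspace.
Variables (R : realType) (V : lmodType R).
Implicit Types A B : nspace R V.

Definition decompositions A B (v : V) : set (V * V) :=
  [set ab | [/\ dom A ab.1, dom B ab.2 & v = ab.1 + ab.2]].

Definition inter_space A B : nspace R V :=
  NSpace (dom A `&` dom B) (fun v => Num.max (nrm A v) (nrm B v)).

Definition sum_space A B : nspace R V :=
  NSpace [set v | decompositions A B v !=set0]
    (fun v => inf [set nrm A ab.1 + nrm B ab.2 | ab in decompositions A B v]).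

Definition Kfunctional A B (t : R) (v : V) : R :=
  inf [set nrm A ab.1 + t * nrm B ab.2 | ab in decompositions A B v].

Definition continuous_inclusion A B :=
  dom A `<=` dom B /\
  forall v, dom A v -> forall e : R, 0 < e -> exists2 d : R, 0 < d &
    forall w, dom A w -> nrm A (w - v) < d -> nrm B (w - v) < e.

Definition equivalent_spaces A B :=
  dom A = dom B /\
  exists c C : R, [/\ 0 < c, 0 < C & forall v, dom A v ->
    c * nrm A v <= nrm B v <= C * nrm A v].

End Nspace.

(* Every subspace below carries the lattice operations of V, so an inclusion is
   automatically a lattice homomorphism. *)
Definition interval_preserving_inclusion (R : realType)
    (V : vectorLatticeType R) (A B : nspace R V) :=
  forall u, dom A u -> 0 <= u ->
    [set w | dom A w /\ 0 <= w <= u] = [set w | dom B w /\ 0 <= w <= u].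

Record qblCouple (R : realType) := QBLCouple {
  space0 : quasiBanachLatticeType R ;
  space1 : quasiBanachLatticeType R ;
  ambient : topVectorLatticeType R ;
  ambient_hausdorff : hausdorff_space ambient ;
  emb0 : {linear space0 -> ambient} ;
  emb1 : {linear space1 -> ambient} ;
  emb0_inj : injective emb0 ;
  emb1_inj : injective emb1 ;
  emb0_hom : lattice_hom emb0 ;
  emb1_hom : lattice_hom emb1 ;
  emb0_itv : interval_preserving emb0 ;
  emb1_itv : interval_preserving emb1 ;
  emb0_cont : qnorm_continuous emb0 ;
  emb1_cont : qnorm_continuous emb1 ;
}.

Section Couple.
Variables (R : realType) (XX : qblCouple R).

Definition p_convex_couple (p : R) :=
  p_convex p (space0 XX) /\ p_convex p (space1 XX).

Definition endpoint0 : nspace R (ambient XX) := image_space (@emb0 R XX).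
Definition endpoint1 : nspace R (ambient XX) := image_space (@emb1 R XX).

Definition Delta := inter_space endpoint0 endpoint1.
Definition Sigma := sum_space endpoint0 endpoint1.
Definition K (t : R) (v : ambient XX) : R := Kfunctional endpoint0 endpoint1 t v.

(* The inclusion of the space into Sigma is given by an injective lattice
   homomorphism into the ambient lattice, with respect to which all the
   conditions are expressed. *)
Record intermediate := Intermediate {
  carrier : quasiBanachLatticeType R ;
  emb : {linear carrier -> ambient XX} ;
  emb_inj : injective emb ;
  emb_hom : lattice_hom emb ;
  Delta_cont : continuous_inclusion Delta (image_space emb) ;
  Delta_itv : interval_preserving_inclusion Delta (image_space emb) ;
  Sigma_cont : continuous_inclusion (image_space emb) Sigma ;
  Sigma_itv : interval_preserving_inclusion (image_space emb) Sigma ;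
}.

Definition space_of (X : intermediate) : nspace R (ambient XX) :=
  image_space (@emb X).

Definition K_monotone (X : intermediate) :=
  forall x y, dom (space_of X) x -> dom Sigma y ->
    (forall t : R, 0 < t -> K t y <= K t x) -> dom (space_of X) y.

Definition uniformly_K_monotone (X : intermediate) :=
  K_monotone X /\
  exists C : R, forall x y, dom (space_of X) x -> dom Sigma y ->
    (forall t : R, 0 < t -> K t y <= K t x) ->
    nrm (space_of X) y <= C * nrm (space_of X) x.

Definition Kpq_monotone (p q : R) (X : intermediate) :=
  exists2 C : R, 0 < C &
    forall (x_ : nat -> ambient XX) (x : ambient XX),
      (forall i, dom (space_of X) (x_ i)) ->
      (\sum_(0 <= i <oo) (nrm (space_of X) (x_ i) `^ q)%:E < +oo)%E ->
      dom Sigma x ->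
      (forall t : R, 0 < t ->
         ((K t x)%:E <=
          (\sum_(0 <= i <oo) (K t (x_ i) `^ p)%:E) `^ p^-1)%E) ->
      dom (space_of X) x /\
      ((nrm (space_of X) x)%:E <=
       C%:E * (\sum_(0 <= i <oo) (nrm (space_of X) (x_ i) `^ q)%:E) `^ q^-1)%E.

Definition IntKM : set intermediate := [set X | uniformly_K_monotone X].

Definition IntKM_pq (p q : R) : set intermediate :=
  [set X | Kpq_monotone p q X].

End Couple.

Section FunctionLattice.
Variable R : realType.

Definition half_line : set R := `]0, +oo[%classic.

Lemma measurable_half_line : measurable half_line.
Proof. exact: measurable_itv. Qed.

Definition half_line_measure : set (measurableTypeR R) -> \bar R :=
  mrestr (@lebesgue_measure R) measurable_half_line.

HB.instance Definition _ := Measure.on half_line_measure.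

(* Functions are total on R, but only their values on (0, oo), up to almost
   everywhere equality, are relevant. *)
Definition Linfty_weighted (w : R -> R) : nspace R (R -> R) :=
  NSpace
    [set f : R -> R | measurable_fun half_line f /\
             (Lnorm half_line_measure +oo (fun t : R => (f t * w t)%:E) < +oo)%E]
    (fun f => fine (Lnorm half_line_measure +oo (fun t : R => (f t * w t)%:E))).

Definition Linfty : nspace R (R -> R) := Linfty_weighted (fun=> 1).
Definition Linfty_inv : nspace R (R -> R) := Linfty_weighted (fun t => t^-1).

Definition ae_le (f g : R -> R) := {ae half_line_measure, forall t, f t <= g t}.

Record quasi_banach_function_lattice (E : nspace R (R -> R)) : Prop := {
  qbfl_measurable : forall f, dom E f -> measurable_fun half_line f ;
  qbfl0 : dom E 0 ;
  qbflD : forall f g, dom E f -> dom E g -> dom E (f + g) ;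
  qbflZ : forall (a : R) f, dom E f -> dom E (a *: f) ;
  qbfl_solid : forall f g : R -> R, measurable_fun half_line f -> dom E g ->
    ae_le (fun t => `|f t|) (fun t => `|g t|) ->
    dom E f /\ nrm E f <= nrm E g ;
  qbfl_ge0 : forall f, dom E f -> 0 <= nrm E f ;
  qbfl_eq0 : forall f, dom E f -> nrm E f = 0 ->
    {ae half_line_measure, forall t, f t = 0} ;
  qbfl_normZ : forall (a : R) f, dom E f -> nrm E (a *: f) = `|a| * nrm E f ;
  qbfl_normD : exists C : R, forall f g, dom E f -> dom E g ->
    nrm E (f + g) <= C * (nrm E f + nrm E g) ;
  qbfl_complete : forall u : nat -> R -> R, (forall n, dom E (u n)) ->
    (forall e : R, 0 < e -> exists N : nat, forall m n : nat,
       (N <= m)%N -> (N <= n)%N -> nrm E (u m - u n) < e) ->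
    exists2 l, dom E l & forall e : R, 0 < e -> exists N : nat, forall n : nat,
       (N <= n)%N -> nrm E (u n - l) < e ;
}.

(* By solidity, both inclusions are automatically interval preserving lattice
   homomorphisms. *)
Definition Linfty_intermediate (E : nspace R (R -> R)) :=
  [/\ quasi_banach_function_lattice E,
      continuous_inclusion (inter_space Linfty Linfty_inv) E &
      continuous_inclusion E (sum_space Linfty Linfty_inv)].

Variable XX : qblCouple R.

Definition K_space (E : nspace R (R -> R)) : nspace R (ambient XX) :=
  NSpace [set x | dom (Sigma XX) x /\ dom E (fun t => K t x)]
         (fun x => nrm E (fun t => K t x)).

(* It is not required that E be an interpolation space for the couple
   (Linfty, Linfty_inv): replacing E by its subspace of functions whose least
   concave majorant is in E does not change K_space E. *)
Definition IntK : set (intermediate XX) :=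
  [set X | exists2 E, Linfty_intermediate E &
     equivalent_spaces (space_of X) (K_space E)].

End FunctionLattice.

Arguments IntK {R} XX.
Arguments K_space {R} XX E.
Arguments IntKM {R} XX.
Arguments IntKM_pq {R} XX p q.

(* Main.v *)
Require Import Defs.
From HB Require Import structures.
From mathcomp Require Import all_boot all_order all_algebra.
From mathcomp Require Import all_classical all_reals all_analysis.
From mathcomp Require Import measurable_realfun ess_sup_inf lra.
Set Implicit Arguments.
Unset Strict Implicit.
Unset Printing Implicit Defensive.
Import Order.TTheory GRing.Theory Num.Theory.
Import numFieldNormedType.Exports.
Local Open Scope classical_set_scope.
Local Open Scope ring_scope.

(** In a lattice couple the [K]-functional is monotone in [`|x|]: by Riesz
    decomposition, a decomposition of [y] induces one of every [x] with
    [`|x| <= `|y|] ([K_solid]).  So a single element [z = \sum_i `|z_i|] has a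
    [K]-functional above all the [K t z_i] at once.  This is what replaces the
    splitting of elements ([K]-divisibility): instead of cutting a given [x]
    into pieces controlled by the [z_i], one adds the [z_i] up inside the space
    [X] and compares [x] with their sum.  Every class of spaces in the theorem is
    compared in this way with the class of uniformly [K]-monotone spaces.

    - [K]-monotone implies uniformly [K]-monotone ([K_monotone_uniformly]), by a
      gliding hump.

    - Uniformly [K]-monotone implies [K(p,q)]-monotone
      ([uniformly_K_monotone_Kpq]).  With weights [w_i] such that
      [\sum_i w_i ^ p <= 1], the [l^p] sum of the [K t x_i] is at most the
      supremum of the [K t (x_i / w_i)], hence at most [K t z] for
      [z = \sum_i `|x_i| / w_i].  This series has to converge in [X], which is
      only quasi-normed: an Aoki-Rolewicz estimate ([qnorm_sum_le]) asks for the
      summability of the [r]-th powers of the quasi-norms for some [r > 0], and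
      the choice [1 / q = 1 / p + 1 / r] gives it.  Conversely, sequences with
      one nonzero term show that [K(p,q)]-monotone spaces are uniformly
      [K]-monotone ([Kpq_uniformly_K_monotone]).

    - Uniformly [K]-monotone implies being a [K]-space
      ([uniformly_K_monotone_IntK]).  Unless the [K]-functional vanishes on [X],
      the parameter [E] consists of the functions dominated almost everywhere by
      [K t z] for some [z] in [X], with the infimum of the [qnorm z] as
      quasi-norm; adding up majorants as above
      proves that [E] is complete.  That [K t x] dominated by [K t z] puts [x]
      in [X] is uniform [K]-monotonicity.  Conversely, a [K]-space is uniformly
      [K]-monotone because [E] is solid ([IntK_uniformly_K_monotone]). *)

(** * Vector lattices *)

Section VectorLattice.
Variables (R : realType) (V : vectorLatticeType R).
Implicit Types (x y z a b : V) (c : R).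

Lemma lev_add x y a b : x <= y -> a <= b -> x + a <= y + b.
Proof.
move=> xy ab; apply: (le_trans (vlattice_leD2r _ _ a xy)).
by rewrite ![y + _]addrC; apply: vlattice_leD2r.
Qed.

Lemma subv_ge0 x y : (0 <= y - x) = (x <= y).
Proof.
apply/idP/idP => [/(vlattice_leD2r _ _ x)|/(vlattice_leD2r _ _ (- x))].
  by rewrite add0r subrK.
by rewrite subrr.
Qed.

Lemma levN x y : (- x <= - y) = (y <= x).
Proof. by rewrite -[LHS]subv_ge0 opprK addrC subv_ge0. Qed.

Lemma levBlDr x y z : (x - y <= z) = (x <= z + y).
Proof. by rewrite -[LHS]subv_ge0 opprB addrA subv_ge0. Qed.

Lemma lev_addr x y : 0 <= y -> x <= x + y.
Proof. by move=> y0; rewrite -{1}[x]addr0 lev_add. Qed.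

Lemma lev_scale c x y : 0 <= c -> x <= y -> c *: x <= c *: y.
Proof.
move=> c0; rewrite -[x <= y]subv_ge0 -[c *: x <= _]subv_ge0 -scalerBr.
exact: vlattice_scale_ge0.
Qed.

Lemma le_vjoinl x y : x <= vjoin x y.
Proof. by have := lexx (vjoin x y); rewrite vjoin_lub => /andP[]. Qed.

Lemma le_vjoinr x y : y <= vjoin x y.
Proof. by have := lexx (vjoin x y); rewrite vjoin_lub => /andP[]. Qed.

Lemma vmeet_lel x y : vmeet x y <= x.
Proof. by have := lexx (vmeet x y); rewrite vmeet_glb => /andP[]. Qed.

Lemma vmeet_ler x y : vmeet x y <= y.
Proof. by have := lexx (vmeet x y); rewrite vmeet_glb => /andP[]. Qed.

Lemma vmeet_idl x y : x <= y -> vmeet x y = x.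
Proof.
by move=> xy; apply/le_anti; rewrite vmeet_lel vmeet_glb lexx xy.
Qed.

Lemma vabs_le x y : (vabs x <= y) = (x <= y) && (- x <= y).
Proof. exact: vjoin_lub. Qed.

Lemma le_vabs x : x <= vabs x. Proof. exact: le_vjoinl. Qed.

Lemma le_vabsN x : - x <= vabs x. Proof. exact: le_vjoinr. Qed.

Lemma vabs_ge0 x : 0 <= vabs x.
Proof.
have h : 0 <= 2%:R *: vabs x.
  by rewrite scaler_nat mulr2n -(subrr x) lev_add ?le_vabs ?le_vabsN.
have /(lev_scale _) := h; move=> /(_ 2%:R^-1).
by rewrite scaler0 scalerA mulVf ?pnatr_eq0// scale1r; apply; rewrite invr_ge0.
Qed.

Lemma vabs_id x : 0 <= x -> vabs x = x.
Proof.
move=> x0; apply/le_anti; rewrite le_vabs vabs_le lexx andbT/=.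
by apply: (le_trans _ x0); rewrite -levN opprK oppr0.
Qed.

Lemma vabs0 : vabs 0 = 0 :> V. Proof. exact: vabs_id. Qed.

Lemma vabs_vabs x : vabs (vabs x) = vabs x.
Proof. exact/vabs_id/vabs_ge0. Qed.

Lemma vabsN x : vabs (- x) = vabs x.
Proof.
have le y : vabs (- y) <= vabs y by rewrite vabs_le opprK le_vabs le_vabsN.
by apply/le_anti; rewrite le -{1}[x]opprK le.
Qed.

Lemma vabsD x y : vabs (x + y) <= vabs x + vabs y.
Proof. by rewrite vabs_le opprD !lev_add ?le_vabs ?le_vabsN. Qed.

Lemma vabsZ_le c x : vabs (c *: x) <= `|c| *: vabs x.
Proof.
rewrite vabs_le; have [c0|/ltW c0] := ger0P c.
  by rewrite -scalerN !lev_scale ?le_vabs ?le_vabsN.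
by rewrite -scaleNr -[c *: x]opprK -scaleNr -scalerN !lev_scale ?oppr_ge0
   ?le_vabs ?le_vabsN.
Qed.

Lemma vabsZ c x : vabs (c *: x) = `|c| *: vabs x.
Proof.
apply/le_anti; rewrite vabsZ_le/=.
have [->|c0] := eqVneq c 0; first by rewrite normr0 !scale0r vabs0.
have := lev_scale (normr_ge0 c) (vabsZ_le c^-1 (c *: x)).
by rewrite !scalerA -normrM mulVf// mulfV// normr1 !scale1r.
Qed.

(** The Riesz decomposition property in its sharpest form: the first summand is
    [x] truncated at the level [|a|], and what the truncation removes is at most
    [|b|]. *)
Lemma vabs_truncation x a b : vabs x <= vabs a + vabs b ->
  exists a' b', [/\ x = a' + b', vabs a' <= vabs a, vabs b' <= vabs b &
    0 <= x -> 0 <= a' /\ 0 <= b'].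
Proof.
rewrite vabs_le => /andP[xab Nxab].
pose a' := vjoin (vmeet x (vabs a)) (- vabs a).
have lea'x : - vabs a <= x -> a' <= x by move=> ?; rewrite vjoin_lub vmeet_lel.
have a'ge : vmeet x (vabs a) <= a' by rewrite le_vjoinl.
have Na0 : - vabs a <= 0 by rewrite -levN opprK oppr0 vabs_ge0.
exists a', (x - a'); split; first by rewrite addrC subrK.
- rewrite vabs_le vjoin_lub vmeet_ler (le_trans Na0 (vabs_ge0 _))/=.
  by rewrite -levN opprK le_vjoinr.
- rewrite vabs_le opprB !levBlDr; apply/andP; split.
    rewrite addrC -levBlDr; apply: (le_trans _ a'ge).
    by rewrite vmeet_glb !levBlDr xab lev_addr ?vabs_ge0.
  rewrite vjoin_lub (le_trans (vmeet_lel _ _))/=; last first.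
    by rewrite addrC lev_addr ?vabs_ge0.
  by rewrite [_ + x]addrC -levBlDr -opprD -[x]opprK levN.
- move=> x0; split.
    by apply: (le_trans _ a'ge); rewrite vmeet_glb x0 vabs_ge0.
  by rewrite subv_ge0; apply/lea'x/(le_trans Na0).
Qed.

End VectorLattice.

(** * Series in quasi-Banach lattices *)

Lemma sum_ord_sub (M : zmodType) (f : nat -> M) k m : (k <= m)%N ->
  \sum_(i < m) f i - \sum_(i < k) f i = \sum_(k <= i < m) f i.
Proof.
move=> km; rewrite -!(big_mkord predT f) (big_cat_nat (leq0n k) km)/=.
by rewrite addrAC subrr add0r.
Qed.

Lemma expr_powR (R : realType) (b a : R) i : 0 <= b ->
  (b `^ a) ^+ i = (b ^+ i) `^ a.
Proof.
by move=> b0; elim: i => [|i IH]; rewrite ?powR1// !exprS IH powRM ?exprn_ge0.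
Qed.

Section QuasiBanachLattice.
Variables (R : realType) (X : quasiBanachLatticeType R).
Implicit Types (x y z : X).

Lemma qnorm_le x y : vabs x <= vabs y -> qnorm x <= qnorm y.
Proof. exact: le_qnorm. Qed.

Lemma qnorm0 : qnorm (0 : X) = 0.
Proof. by have := qnormZ 0 (0 : X); rewrite scale0r normr0 mul0r. Qed.

Lemma qnorm_vabs x : qnorm (vabs x) = qnorm x.
Proof. by apply/le_anti/andP; split; apply: qnorm_le; rewrite vabs_vabs. Qed.

Lemma qnormN x : qnorm (- x) = qnorm x.
Proof. by apply/le_anti/andP; split; apply: qnorm_le; rewrite vabsN. Qed.

Lemma qnormB x y : qnorm (x - y) = qnorm (y - x).
Proof. by rewrite -qnormN opprB. Qed.

Lemma qnorm_quasi_triangle : exists2 C : R, 1 <= C &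
  forall x y, qnorm (x + y) <= C * (qnorm x + qnorm y).
Proof.
have [C CD] := @qnormD R X; exists (Num.max 1 C); first by rewrite le_max lexx.
move=> x y; apply: (le_trans (CD x y)).
by rewrite ler_wpM2r ?addr_ge0 ?qnorm_ge0// le_max lexx orbT.
Qed.

(** The element [x] is the one at which the partial sums of [f] pass [h]. *)
Lemma sum_split_at (f : X -> R) (s : seq X) (h : R) : (forall x, 0 <= f x) ->
  s != [::] -> 0 <= h -> h <= \sum_(x <- s) f x ->
  exists s1 x s2, [/\ s = s1 ++ x :: s2, \sum_(x <- s1) f x <= h &
    \sum_(x <- s2) f x <= \sum_(x <- s) f x - h].
Proof.
move=> f0; elim: s h => // x s IH h _ h0 hs.
have [hx|xh] := leP h (f x).
  exists [::], x, s; split=> //; first by rewrite big_nil.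
  by rewrite big_cons; lra.
rewrite big_cons in hs *.
have sN0 : s != [::] by apply: contraTneq hs => ->; rewrite big_nil; lra.
have [||s1 [y [s2 [-> h1 h2]]]] := IH (h - f x) sN0; [lra|lra|].
exists (x :: s1), y, s2; split; [by []|by rewrite big_cons; lra|by lra].
Qed.

(** A quantitative form of the Aoki-Rolewicz theorem: the quasi-norm of a sum is
    controlled by the [1/n]-th powers of the quasi-norms.  The list is cut at
    the term where the sum of these powers passes half of its value; each of the
    two outer pieces then gains a factor [2 ^ n], which absorbs the constant of
    the quasi-triangle inequality used to put the three pieces together. *)
Lemma qnorm_sum_le : exists (n : nat) (B : R), [/\ (0 < n)%N, 0 < B &
  forall s : seq X, qnorm (\sum_(x <- s) x) <=
    B * (\sum_(x <- s) qnorm x `^ n%:R^-1) ^+ n].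
Proof.
have [C C1 CD] := qnorm_quasi_triangle.
have C0 : 0 < C by lra.
(* [2 ^ n] has to beat [2 * (C + C ^ 2)], the cost of joining three pieces *)
have [n n0 nC] : exists2 n, (0 < n)%N & 4 * C ^+ 2 <= 2 ^+ n.
  exists (Num.truncn (4 * C ^+ 2)).+1 => //.
  have /ltW := truncnS_gt (4 * C ^+ 2); move/le_trans; apply.
  by rewrite -natrX ler_nat ltnW// ltn_expl.
have f0 (x : X) : 0 <= qnorm x `^ n%:R^-1 by apply: powR_ge0.
have S0 (s : seq X) : 0 <= \sum_(x <- s) qnorm x `^ n%:R^-1 by apply: sumr_ge0.
have fn x : (qnorm x `^ n%:R^-1) ^+ n = qnorm x.
  rewrite -powR_mulrn// -powRrM mulVf ?pnatr_eq0 -?lt0n//.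
  by rewrite powRr1 ?qnorm_ge0.
have halfP (s : seq X) (S : R) : 0 <= S ->
    \sum_(x <- s) qnorm x `^ n%:R^-1 <= S / 2 ->
    2 * C ^+ 2 * (\sum_(x <- s) qnorm x `^ n%:R^-1) ^+ n <= S ^+ n / 2.
  move=> S_ge0 hs; have h : (\sum_(x <- s) qnorm x `^ n%:R^-1) ^+ n <= (S / 2) ^+ n.
    by rewrite lerXn2r ?nnegrE// divr_ge0.
  apply: (le_trans (ler_wpM2l _ h)); first by rewrite mulr_ge0// sqr_ge0.
  rewrite expr_div_n mulrA ler_pdivrMr ?exprn_gt0// -mulrA.
  have := exprn_ge0 n S_ge0; set T := S ^+ n => T0.
  rewrite mulrC [leRHS]mulrC -subr_ge0 -mulrA mulrC -mulrA.
  by nra.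
exists n, (2 * C ^+ 2); split=> //; first by rewrite mulr_gt0// exprn_gt0.
move=> s; have [m] := ubnP (size s); elim: m s => // m IH s.
have [->|sN0] := eqVneq s [::].
  by rewrite !big_nil qnorm0 expr0n eqn0Ngt n0/= mulr0.
set S := \sum_(x <- s) _ => ss.
have S_ge0 : 0 <= S by exact: S0.
have [||s1 [x [s2 [sE h1 h2]]]] := sum_split_at (h := S / 2) f0 sN0.
- by rewrite divr_ge0.
- by rewrite -/S; lra.
rewrite -/S in h2.
have h2' : \sum_(x <- s2) qnorm x `^ n%:R^-1 <= S / 2 by lra.
move: ss; rewrite sE size_cat/= ltnS => ss.
have i1 : qnorm (\sum_(x <- s1) x) <= S ^+ n / 2.
  apply: (le_trans (IH _ _) (halfP _ _ S_ge0 h1)).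
  by apply: leq_trans ss; rewrite -addSnnS leq_addr.
have i2 : qnorm (\sum_(x <- s2) x) <= S ^+ n / 2.
  apply: (le_trans (IH _ _) (halfP _ _ S_ge0 h2')).
  by apply: leq_trans ss; rewrite leq_addl.
have ix : qnorm x <= S ^+ n.
  rewrite -fn lerXn2r ?nnegrE//.
  by rewrite /S sE big_cat big_cons/= [leRHS]addrC -addrA lerDl addr_ge0.
rewrite big_cat big_cons/=; apply: (le_trans (CD _ _)).
have j := CD x (\sum_(x <- s2) x).
have T0 : 0 <= S ^+ n by exact: exprn_ge0.
have CS : C * (qnorm x + qnorm (\sum_(x <- s2) x)) <= C * (S ^+ n + S ^+ n / 2).
  by rewrite ler_pM2l// lerD.
have h12 := lerD i1 (le_trans j CS).
have -> : 2 * C ^+ 2 * S ^+ n = C * (2 * C * S ^+ n) by lra.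
by rewrite ler_pM2l//; apply: (le_trans h12); nra.
Qed.

Definition qnorm_cvg (u : nat -> X) (l : X) := forall e : R, 0 < e ->
  exists N : nat, forall k, (N <= k)%N -> qnorm (u k - l) < e.

(** The negative part of [x] is at most [`|y - x|] for every [y >= 0]. *)
Lemma qnorm_lim_ge0 x : (forall e, 0 < e -> exists2 y, 0 <= y & qnorm (y - x) < e) ->
  0 <= x.
Proof.
move=> xP; rewrite -[x]opprK -oppr0 levN.
suff /qnorm0_eq0 <- : qnorm (vjoin (- x) 0) = 0 by exact: le_vjoinl.
apply/le_anti; rewrite qnorm_ge0 andbT; apply/ler_addgt0Pl => e e0.
rewrite addr0; have [y y0 /ltW] := xP _ e0; apply/le_trans/qnorm_le.
rewrite vabs_id ?le_vjoinr// vjoin_lub vabs_ge0 andbT.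
by apply: le_trans (le_vabs _); rewrite addrC lev_addr.
Qed.

Lemma qnorm_series : exists (n : nat) (B : R), [/\ (0 < n)%N, 0 < B &
  forall (z : nat -> X) (S : R),
  (forall k, \sum_(i < k) qnorm (z i) `^ n%:R^-1 <= S) ->
  exists l, [/\ qnorm_cvg (fun k => \sum_(i < k) z i) l, qnorm l <= B * S ^+ n &
    (forall i, 0 <= z i) -> forall i, z i <= l]].
Proof.
have [n [B [n0 B0 sumP]]] := qnorm_sum_le.
have [C C1 CD] := qnorm_quasi_triangle.
have C0 : 0 < C by lra.
exists n, (C * B); split=> //; first exact: mulr_gt0.
move=> z S zS; pose T k := \sum_(i < k) qnorm (z i) `^ n%:R^-1.
have T0 k : 0 <= T k by apply: sumr_ge0 => i _; exact: powR_ge0.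
have TS k m : (k <= m)%N -> T k <= T m.
  move=> /subnK <-; elim: (m - k)%N => // j IH; apply: (le_trans IH).
  by rewrite addSn /T big_ord_recr/= lerDl powR_ge0.
pose s k := \sum_(i < k) z i.
have sT k m : (k <= m)%N -> qnorm (s m - s k) <= B * (T m - T k) ^+ n.
  move=> km; have -> : s m - s k = \sum_(x <- [seq z i | i <- index_iota k m]) x.
    by rewrite big_map; exact: sum_ord_sub.
  apply: (le_trans (sumP _)); rewrite big_map.
  by rewrite /T (sum_ord_sub (fun i => qnorm (z i) `^ n%:R^-1)).
have sc e : 0 < e -> exists N, forall m, (N <= m)%N -> qnorm (s m - s N) < e.
  move=> e0; have hs : has_sup (range T).
    by split; [exists (T 0%N), 0%N|exists S => _ [k _ <-]; exact: zS].
  pose d := Num.min 1 (e / (2 * B)).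
  have d0 : 0 < d by rewrite lt_min ltr01 divr_gt0 ?mulr_gt0.
  have [_ [N _ <-] TN] := sup_adherent d0 hs.
  exists N => m Nm; apply: (le_lt_trans (sT _ _ Nm)).
  have dT : T m - T N <= d.
    have : T m <= sup (range T) by apply: (ub_le_sup hs.2); exists m.
    by move: TN; lra.
  have dT0 : 0 <= T m - T N by rewrite subr_ge0 TS.
  have d1 : T m - T N <= 1 by apply: (le_trans dT); rewrite ge_min lexx.
  apply: (@le_lt_trans _ _ (B * (e / (2 * B)))).
    rewrite ler_pM2l// (le_trans _ (_ : d <= _)) ?ge_min ?lexx ?orbT//.
    by rewrite (le_trans _ dT)// -[leRHS]expr1 ler_wiXn2l.
  have -> : B * (e / (2 * B)) = e / 2.
    by rewrite invfM mulrCA [_ / B]mulrC mulVKf// gt_eqF.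
  by lra.
have [|l lP] := qnorm_complete s.
  move=> e e0; have [|N NP] := sc (e / (2 * C)); first by rewrite divr_gt0 ?mulr_gt0.
  exists N => i j iN jN; rewrite -(subrKA (s N)).
  apply: (le_lt_trans (CD _ _)); rewrite [qnorm (s N - _)]qnormB.
  have := NP _ iN; have := NP _ jN; rewrite !ltr_pdivlMr ?mulr_gt0//.
  by nra.
exists l; split=> //.
- apply/ler_addgt0Pl => e e0; have [|N NP] := lP (e / C); first exact: divr_gt0.
  rewrite -(subrK (s N) l); apply: (le_trans (CD _ _)).
  have := NP N (leqnn _); rewrite qnormB ltr_pdivlMr// => h1.
  have : qnorm (s N) <= B * S ^+ n.
    have := sT 0%N N (leq0n _); rewrite /s big_ord0 subr0 => /le_trans; apply.
    rewrite /T big_ord0 subr0 ler_pM2l// lerXn2r ?nnegrE ?T0 ?zS//.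
    exact: le_trans (T0 N) (zS N).
  by rewrite -mulrA -(ler_pM2l C0); lra.
- move=> z0 i; rewrite -subv_ge0; apply: qnorm_lim_ge0 => e /lP[N NP].
  exists (s (maxn N i.+1) - z i); last by rewrite opprB addrA subrK NP// leq_maxl.
  rewrite subv_ge0; have : (i < maxn N i.+1)%N by rewrite leq_maxr.
  elim: (maxn N i.+1) => // k IH; rewrite ltnS leq_eqVlt => /orP[/eqP ->|ik].
    rewrite /s big_ord_recr/= addrC lev_addr//.
    by elim/big_ind: _ => // x y x0 y0; rewrite -[0]addr0 lev_add.
  by rewrite /s big_ord_recr/= (le_trans (IH ik))// lev_addr.
Qed.

Lemma qnorm_geometric_series : exists2 B : R, 0 < B &
  forall (z : nat -> X) (s : R), (forall i, qnorm (z i) <= s * 2^-1 ^+ i) ->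
  exists l, [/\ qnorm_cvg (fun k => \sum_(i < k) z i) l, qnorm l <= B * s &
    (forall i, 0 <= z i) -> forall i, z i <= l].
Proof.
have [n [B [n0 B0 serP]]] := qnorm_series.
pose rho : R := 2^-1 `^ n%:R^-1.
have rho0 : 0 <= rho by exact: powR_ge0.
have nK (a : R) : 0 <= a -> (a `^ n%:R^-1) ^+ n = a.
  move=> a0; rewrite -powR_mulrn ?powR_ge0// -powRrM mulVf ?pnatr_eq0 -?lt0n//.
  by rewrite powRr1.
have rho1 : rho < 1.
  rewrite ltNge; apply/negP => /(exprn_ege1 n); rewrite nK ?invr_ge0//.
  by move=> h; lra.
exists (B * (1 - rho)^-1 ^+ n); first by
  rewrite mulr_gt0 ?exprn_gt0 ?invr_gt0 ?subr_gt0.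
move=> z s zs; have s0 : 0 <= s.
  by have := zs 0%N; rewrite expr0 mulr1; apply/le_trans/qnorm_ge0.
have [k|l [lc lB lz]] := serP z (s `^ n%:R^-1 * (1 - rho)^-1).
  apply: (@le_trans _ _ (\sum_(i < k) s `^ n%:R^-1 * rho ^+ i)).
    apply: ler_sum => i _; rewrite expr_powR ?invr_ge0//.
    rewrite -powRM ?exprn_ge0 ?invr_ge0//.
    by rewrite ge0_ler_powR ?nnegrE ?qnorm_ge0 ?mulr_ge0 ?exprn_ge0 ?invr_ge0.
  rewrite -mulr_sumr ler_wpM2l ?powR_ge0// -[leRHS]mul1r ler_pdivlMr ?subr_gt0//.
  have := subrX1 rho k; have := exprn_ge0 k rho0; set U := \sum_(i < k) _.
  by nra.
exists l; split=> //; move: lB; rewrite exprMn nK// => /le_trans; apply.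
by rewrite mulrCA mulrC.
Qed.

End QuasiBanachLattice.

(** * The K-functional of a lattice couple *)

Section Embedding.
Variables (R : realType) (U V : vectorLatticeType R) (f : {linear U -> V}).
Hypotheses (f_inj : injective f) (f_hom : lattice_hom f).

Lemma hom_vabs x : f (vabs x) = vabs (f x).
Proof. by rewrite /vabs f_hom.1 linearN. Qed.

(** An injective lattice homomorphism reflects the order because [x <= y] is
    the equation [vmeet x y = x]. *)
Lemma hom_le x y : (f x <= f y) = (x <= y).
Proof.
apply/idP/idP => [xy|xy].
  by rewrite -(f_inj (etrans (f_hom.2 x y) (vmeet_idl xy))) vmeet_ler.
by rewrite -(vmeet_idl xy) f_hom.2 vmeet_ler.
Qed.

Lemma hom_ge0 x : (0 <= f x) = (0 <= x).
Proof. by rewrite -(linear0 f) hom_le. Qed.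

(** The interval [[- `|f x|, `|f x|]] is translated by [`|f x|], as the
    hypothesis only concerns intervals that start at [0]. *)
Lemma interval_preserving_solid x v : interval_preserving f ->
  vabs v <= vabs (f x) -> exists2 u, f u = v & vabs u <= vabs x.
Proof.
move=> fitv; rewrite vabs_le -hom_vabs => /andP[h1 h2].
have : [set w | 0 <= w <= f (vabs x + vabs x)] (v + f (vabs x)).
  rewrite /= linearD -subv_ge0 subr0; apply/andP; split; last by rewrite lev_add.
  by rewrite addrC -[v]opprK subv_ge0.
rewrite -fitv => [[w _ wE]|]; last by rewrite -[0]addr0 lev_add ?vabs_ge0.
have fw : f (w - vabs x) = v by rewrite linearB wE/= addrK.
exists (w - vabs x) => //.
by rewrite -hom_le !hom_vabs fw vabs_le -hom_vabs h1.
Qed.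

End Embedding.

Section ImageSpace.
Variables (R : realType) (X : quasiBanachLatticeType R) (V : Type) (j : X -> V).

Lemma image_dom x : dom (image_space j) (j x).
Proof. by exists x. Qed.

Lemma image_nrm x : injective j -> nrm (image_space j) (j x) = qnorm x.
Proof.
move=> j_inj; rewrite /=; congr qnorm.
by case: xgetP => [_ -> /= /j_inj //|/(_ x)]; case.
Qed.

End ImageSpace.

Section Kfunctional.
Variables (R : realType) (XX : qblCouple R).
Implicit Types (v w x y : ambient XX) (s t c e : R).
Implicit Types (a : space0 XX) (b : space1 XX).

Lemma nrm0E a : nrm (endpoint0 XX) (emb0 XX a) = qnorm a.
Proof. exact: (image_nrm a (@emb0_inj _ XX)). Qed.

Lemma nrm1E b : nrm (endpoint1 XX) (emb1 XX b) = qnorm b.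
Proof. exact: (image_nrm b (@emb1_inj _ XX)). Qed.

Lemma SigmaP v : dom (Sigma XX) v <-> exists a b, v = emb0 XX a + emb1 XX b.
Proof.
split=> [[[v0 v1] [/= [a _ <-] [b _ <-] ->]]|[a [b ->]]]; first by exists a, b.
by exists (emb0 XX a, emb1 XX b); split=> //; [exists a|exists b].
Qed.

Lemma Sigma_add a b : dom (Sigma XX) (emb0 XX a + emb1 XX b).
Proof. by apply/SigmaP; exists a, b. Qed.

Let costs t v := [set nrm (endpoint0 XX) ab.1 + t * nrm (endpoint1 XX) ab.2 |
  ab in decompositions (endpoint0 XX) (endpoint1 XX) v].

Let costsP t v c : costs t v c <->
  exists a b, v = emb0 XX a + emb1 XX b /\ c = qnorm a + t * qnorm b.
Proof.
split=> [[[v0 v1] [[a _ aE] [b _ bE] vE] <-]|[a [b [-> ->]]]].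
  by exists a, b; rewrite -nrm0E -nrm1E aE bE.
exists (emb0 XX a, emb1 XX b); last by rewrite -nrm0E -nrm1E.
by split=> //; [exists a|exists b].
Qed.

Let costs_lb t v : 0 <= t -> lbound (costs t v) 0.
Proof.
by move=> t0 _ /costsP[a [b [_ ->]]]; rewrite addr_ge0 ?mulr_ge0 ?qnorm_ge0.
Qed.

Let costs_inf t v : 0 <= t -> dom (Sigma XX) v -> has_inf (costs t v).
Proof.
move=> t0 /SigmaP[a [b ->]]; split; last by exists 0; exact: costs_lb.
by exists (qnorm a + t * qnorm b); apply/costsP; exists a, b.
Qed.

Lemma K_le t a b : 0 <= t ->
  K t (emb0 XX a + emb1 XX b) <= qnorm a + t * qnorm b.
Proof.
move=> t0; apply: ge_inf; first by exists 0; exact: costs_lb.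
by apply/costsP; exists a, b.
Qed.

Lemma K_decomp t v e : 0 <= t -> dom (Sigma XX) v -> 0 < e ->
  exists a b, v = emb0 XX a + emb1 XX b /\ qnorm a + t * qnorm b < K t v + e.
Proof.
move=> t0 Sv e0; have [_ /costsP[a [b [-> ->]]] lt] :=
  inf_adherent e0 (costs_inf t0 Sv).
by exists a, b.
Qed.

Lemma le_K t v c : 0 <= t -> dom (Sigma XX) v ->
  (forall a b, v = emb0 XX a + emb1 XX b -> c <= qnorm a + t * qnorm b) ->
  c <= K t v.
Proof.
move=> t0 Sv cP; apply: lb_le_inf; first exact: (costs_inf t0 Sv).1.
by move=> _ /costsP[a [b [vE ->]]]; exact: cP.
Qed.

Lemma K_ge0 t v : 0 <= t -> dom (Sigma XX) v -> 0 <= K t v.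
Proof.
move=> t0 Sv; apply: le_K => // a b _.
by rewrite addr_ge0 ?mulr_ge0 ?qnorm_ge0.
Qed.

Lemma nrm_Sigma v : nrm (Sigma XX) v = K 1 v.
Proof. by congr inf; apply: eq_imagel => ab _; rewrite mul1r. Qed.

(** Decompositions pass to smaller elements; this is where the embeddings of
    the two spaces have to be interval preserving. *)
Lemma K_decomp_solid v a b : vabs v <= vabs (emb0 XX a + emb1 XX b) ->
  exists a' b', [/\ v = emb0 XX a' + emb1 XX b', qnorm a' <= qnorm a,
    qnorm b' <= qnorm b & 0 <= v -> 0 <= a' /\ 0 <= b'].
Proof.
move=> /le_trans /(_ (vabsD _ _)) /vabs_truncation[v0 [v1 [-> h0 h1 pos]]].
have [a' a'E ?] := interval_preserving_solid (@emb0_inj _ XX) (@emb0_hom _ XX)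
  (@emb0_itv _ XX) h0.
have [b' b'E ?] := interval_preserving_solid (@emb1_inj _ XX) (@emb1_hom _ XX)
  (@emb1_itv _ XX) h1.
exists a', b'; split; [by rewrite a'E b'E|exact: qnorm_le|exact: qnorm_le|].
move=> /pos; rewrite -a'E -b'E.
by rewrite !hom_ge0//; 
  [exact: emb1_inj|exact: emb1_hom|exact: emb0_inj|exact: emb0_hom].
Qed.

Lemma K_decomp_ge0 t v e : 0 <= t -> dom (Sigma XX) v -> 0 <= v -> 0 < e ->
  exists a b, [/\ v = emb0 XX a + emb1 XX b, 0 <= a, 0 <= b &
    qnorm a + t * qnorm b < K t v + e].
Proof.
move=> t0 Sv v0 e0; have [a [b [vE lt]]] := K_decomp t0 Sv e0.
have [|a' [b' [v'E ha hb /(_ v0)[a0 b0]]]] := @K_decomp_solid v a b.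
  by rewrite -vE.
exists a', b'; split=> //; apply: le_lt_trans lt.
by rewrite lerD// ler_wpM2l.
Qed.

Lemma Sigma_solid v w : vabs v <= vabs w -> dom (Sigma XX) w -> dom (Sigma XX) v.
Proof.
move=> vw /SigmaP[a [b wE]]; move: vw; rewrite wE.
by move=> /K_decomp_solid[a' [b' [-> _ _ _]]]; exact: Sigma_add.
Qed.

Lemma K_solid t v w : 0 <= t -> dom (Sigma XX) w -> vabs v <= vabs w ->
  K t v <= K t w.
Proof.
move=> t0 Sw vw; apply: le_K => // a b wE; move: vw; rewrite wE.
move=> /K_decomp_solid[a' [b' [-> ha hb _]]].
by apply: (le_trans (K_le a' b' t0)); rewrite lerD// ler_wpM2l.
Qed.

Lemma SigmaZ c v : dom (Sigma XX) v -> dom (Sigma XX) (c *: v).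
Proof.
move=> /SigmaP[a [b ->]]; apply/SigmaP; exists (c *: a), (c *: b).
by rewrite scalerDr !linearZ.
Qed.

Lemma SigmaD v w : dom (Sigma XX) v -> dom (Sigma XX) w -> dom (Sigma XX) (v + w).
Proof.
move=> /SigmaP[a [b ->]] /SigmaP[c [d ->]]; apply/SigmaP; exists (a + c), (b + d).
by rewrite !linearD addrACA.
Qed.

Lemma KZ t c v : 0 <= t -> dom (Sigma XX) v -> K t (c *: v) = `|c| * K t v.
Proof.
move=> t0; have le d w : dom (Sigma XX) w -> d != 0 -> K t (d *: w) <= `|d| * K t w.
  move=> Sw d0; rewrite -ler_pdivrMl ?normr_gt0//; apply: le_K => // a b ->.
  rewrite ler_pdivrMl ?normr_gt0// scalerDr -!linearZ/=.
  by rewrite (le_trans (K_le _ _ t0))// !qnormZ mulrDr mulrCA.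
have S0 : dom (Sigma XX) 0 by apply/SigmaP; exists 0, 0; rewrite !linear0 addr0.
move=> Sv; have [->|c0] := eqVneq c 0.
  rewrite scale0r normr0 mul0r; apply/le_anti; rewrite K_ge0// andbT.
  have := K_le 0 0 t0; rewrite !linear0 addr0 !qnorm0 mulr0 addr0; exact.
apply/le_anti; rewrite le//= -ler_pdivlMl ?normr_gt0// -normfV.
rewrite -{1}[v]scale1r -(mulVf c0) -scalerA le ?invr_eq0//; exact: SigmaZ.
Qed.

Lemma K_quasi_triangle : exists2 C : R, 1 <= C & forall t v w, 0 <= t ->
  dom (Sigma XX) v -> dom (Sigma XX) w -> K t (v + w) <= C * (K t v + K t w).
Proof.
have [C0 C01 h0] := qnorm_quasi_triangle (space0 XX).
have [C1 C11 h1] := qnorm_quasi_triangle (space1 XX).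
exists (Num.max C0 C1); first by rewrite le_max C01.
move=> t v w t0 Sv Sw; set C := Num.max _ _.
have Cpos : 0 < C by rewrite lt_max (lt_le_trans ltr01 C01).
apply/ler_addgt0Pl => e e0.
have e0' : 0 < e / C / 2 by rewrite !divr_gt0.
have [a [b [-> ltv]]] := K_decomp t0 Sv e0'.
have [c [d [-> ltw]]] := K_decomp t0 Sw e0'.
rewrite addrACA -!linearD (le_trans (K_le _ _ t0))//.
have ha : qnorm (a + c) <= C * (qnorm a + qnorm c).
  by rewrite (le_trans (h0 _ _))// ler_wpM2r ?addr_ge0 ?qnorm_ge0// le_max lexx.
have hb : qnorm (b + d) <= C * (qnorm b + qnorm d).
  by rewrite (le_trans (h1 _ _))// ler_wpM2r ?addr_ge0 ?qnorm_ge0// le_max lexx orbT.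
rewrite (le_trans (lerD ha (ler_wpM2l t0 hb)))//.
have eE : e / C / 2 * 2 * C = e by rewrite !divfK// gt_eqF.
have := ler_wpM2l (ltW Cpos) (ltW (ltrD ltv ltw)).
by rewrite -[in X in _ -> X]eE; lra.
Qed.

Lemma K_homo s t v : 0 <= s -> s <= t -> dom (Sigma XX) v -> K s v <= K t v.
Proof.
move=> s0 st Sv; have t0 := le_trans s0 st; apply: le_K => // a b ->.
by rewrite (le_trans (K_le _ _ s0))// lerD2l ler_wpM2r ?qnorm_ge0.
Qed.

Lemma K_scale_homo s t v : 0 < s -> s <= t -> dom (Sigma XX) v ->
  s * K t v <= t * K s v.
Proof.
move=> s0 st Sv; have t0 := lt_le_trans s0 st; have [s0' t0'] := (ltW s0, ltW t0).
rewrite -ler_pdivrMl//; apply: le_K => // a b ->.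
rewrite ler_pdivrMl// (le_trans (ler_wpM2l s0' (K_le _ _ t0')))//.
rewrite !mulrDr mulrCA lerD// ?ler_wpM2r ?qnorm_ge0//.
Qed.

End Kfunctional.

Section Intermediate.
Variables (R : realType) (XX : qblCouple R) (X : intermediate XX).

Lemma nrmE (z : carrier X) : nrm (space_of X) (emb X z) = qnorm z.
Proof. exact: (image_nrm z (@emb_inj _ _ X)). Qed.

Lemma intermediate_Sigma (z : carrier X) : dom (Sigma XX) (emb X z).
Proof. exact: (Sigma_cont X).1 (image_dom _ _). Qed.

(** The continuity of the inclusion into the sum is a bound, by homogeneity. *)
Lemma K_bound : exists2 D : R, 0 < D & forall z : carrier X,
  K 1 (emb X z) <= D * qnorm z.
Proof.
have [_ /(_ (emb X 0)) /(_ (image_dom _ _)) /(_ 1 ltr01)[d d0 dP]] := Sigma_cont X.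
exists (2 / d); first by rewrite divr_gt0.
move=> z; have [/qnorm0_eq0 ->|z0] := eqVneq (qnorm z) 0.
  rewrite qnorm0 mulr0 -(scale0r (0 : carrier X)) linearZ/= KZ ?normr0 ?mul0r//.
  exact: intermediate_Sigma.
have zpos : 0 < qnorm z by rewrite lt_def z0 qnorm_ge0.
pose c := d / 2 / qnorm z; have c0 : 0 < c by rewrite !divr_gt0.
have := dP (emb X (c *: z)) (image_dom _ _); rewrite linear0 subr0.
have -> : nrm (image_space (emb X)) (emb X (c *: z)) = c * qnorm z.
  by rewrite (image_nrm _ (@emb_inj _ _ X)) qnormZ gtr0_norm.
rewrite nrm_Sigma linearZ/= KZ ?ler01//; last exact: intermediate_Sigma.
rewrite gtr0_norm// /c divfK// => /(_ _)/ltW.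
rewrite -ler_pdivlMl ?divr_gt0// mulr1 invfM invrK invf_div mulrC; apply; lra.
Qed.

End Intermediate.

(** * From K-monotone to uniformly K-monotone *)

Lemma qnorm_cvg_image (R : realType) (X : quasiBanachLatticeType R)
    (V : topologicalType) (f : X -> V) (u : nat -> X) (l : X) :
  qnorm_continuous f -> qnorm_cvg u l -> f (u n) @[n --> \oo] --> f l.
Proof.
move=> fc ul U /fc[d d0 dU]; have [N NP] := ul _ d0.
by exists N => // k /= Nk; apply/dU/NP.
Qed.

Section SigmaSeries.
Variables (R : realType) (XX : qblCouple R).
Implicit Types (v : nat -> ambient XX) (k : R -> R).

(** Summing near-optimal decompositions of the [v n] gives a decomposition of
    their sum which depends on [t]; that all of them decompose the same vector
    is the uniqueness of limits in the ambient space. *)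
Lemma Sigma_geometric_series : exists2 B : R, 0 < B & forall v k,
  (forall n, 0 <= v n) -> (forall n, dom (Sigma XX) (v n)) ->
  (forall n t, 0 < t -> K t (v n) <= k t * 2^-1 ^+ n) ->
  exists y, [/\ dom (Sigma XX) y, forall n, v n <= y &
    forall t, 0 < t -> K t y <= B * k t].
Proof.
have [B0 B0pos ser0] := qnorm_geometric_series (space0 XX).
have [B1 B1pos ser1] := qnorm_geometric_series (space1 XX).
exists (B0 + B1); first exact: addr_gt0.
move=> v k v0 Sv vk; pose p n : R := 2^-1 ^+ n.
have p0 n : 0 < p n by rewrite exprn_gt0// invr_gt0.
have decomp t e : 0 < t -> 0 < e -> exists a b,
    [/\ \sum_(i < n) v i @[n --> \oo] --> emb0 XX a + emb1 XX b,
      forall n, v n <= emb0 XX a + emb1 XX b,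
      qnorm a <= B0 * (k t + e) & t * qnorm b <= B1 * (k t + e)].
  move=> t0 e0.
  have /choice[ab abP] n : exists ab : space0 XX * space1 XX,
      [/\ v n = emb0 XX ab.1 + emb1 XX ab.2, 0 <= ab.1, 0 <= ab.2 &
        qnorm ab.1 + t * qnorm ab.2 <= (k t + e) * p n].
    have [a [b [vE a0 b0 lt]]] :=
      K_decomp_ge0 (ltW t0) (Sv n) (v0 n) (mulr_gt0 e0 (p0 n)).
    exists (a, b); split=> //; apply: (le_trans (ltW lt)).
    by rewrite mulrDl lerD2r vk.
  have [n|a [acvg aB ale]] := ser0 (fun n => (ab n).1) (k t + e).
    have [_ _ _ le] := abP n; apply: le_trans le.
    by rewrite lerDl mulr_ge0 ?qnorm_ge0 ?ltW.
  have [n|b [bcvg bB ble]] := ser1 (fun n => (ab n).2) ((k t + e) / t).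
    have [_ _ _ le] := abP n.
    rewrite mulrAC ler_pdivlMr// mulrC; apply: le_trans le.
    by rewrite lerDr qnorm_ge0.
  exists a, b; split=> //.
  - have vE n : \sum_(i < n) v i =
        emb0 XX (\sum_(i < n) (ab i).1) + emb1 XX (\sum_(i < n) (ab i).2).
      rewrite !linear_sum -big_split/=; apply: eq_bigr => i _.
      by have [] := abP i.
    under eq_fun do rewrite vE.
    have acvg' := qnorm_cvg_image (@emb0_cont _ XX) acvg.
    have bcvg' := qnorm_cvg_image (@emb1_cont _ XX) bcvg.
    exact: (cvg_comp2 acvg' bcvg'
      (@add_continuous (ambient XX) (emb0 XX a, emb1 XX b))).
  - move=> n; have [-> _ _ _] := abP n; apply: lev_add.
      rewrite (hom_le (@emb0_inj _ XX) (@emb0_hom _ XX)).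
      by apply: ale => i; have [] := abP i.
    rewrite (hom_le (@emb1_inj _ XX) (@emb1_hom _ XX)).
    by apply: ble => i; have [] := abP i.
  - by rewrite -ler_pdivlMl// mulrC -mulrA.
have [a [b [ycvg yge _ _]]] := decomp 1 1 ltr01 ltr01.
exists (emb0 XX a + emb1 XX b); split=> //; first exact: Sigma_add.
move=> t t0; apply/ler_addgt0Pl => e e0.
have e0' : 0 < e / (B0 + B1) by rewrite divr_gt0// addr_gt0.
have [a' [b' [y'cvg _ ha hb]]] := decomp t _ t0 e0'.
rewrite (cvg_unique _ ycvg y'cvg); last exact: ambient_hausdorff.
rewrite (le_trans (K_le _ _ (ltW t0)))// (le_trans (lerD ha hb))//.
by rewrite -mulrDl mulrDr addrC lerD2r mulrCA mulfV ?mulr1// gt_eqF ?addr_gt0.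
Qed.

End SigmaSeries.

Section KMonotone.
Variables (R : realType) (XX : qblCouple R) (X : intermediate XX).
Implicit Types (z w : carrier X) (t : R).

Lemma K_emb_solid t z w : 0 <= t -> vabs z <= vabs w ->
  K t (emb X z) <= K t (emb X w).
Proof.
move=> t0 zw; apply: K_solid => //; first exact: intermediate_Sigma.
by rewrite -!(hom_vabs (@emb_hom _ _ X)) (hom_le (@emb_inj _ _ X) (@emb_hom _ _ X)).
Qed.

(** A gliding hump.  If no constant works, there are [w n] of quasi-norm [4 ^ n]
    with [K]-functionals below those of [z n], of quasi-norm at most [2 ^ - n].
    The sum [x] of the [`|z n|] is then in the space, and so is the sum [y] of
    the [2 ^ - n `|w n|], its [K]-functional being at most a multiple of that of
    [x].  But [y] dominates elements of quasi-norm [2 ^ n] for all [n]. *)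
Lemma K_monotone_uniformly : K_monotone X -> uniformly_K_monotone X.
Proof.
move=> Xmono; split=> //; apply: contrapT => Nunif.
have /choice[zw zwP] n : exists zw : carrier X * carrier X,
    [/\ qnorm zw.1 <= 2^-1 ^+ n, qnorm zw.2 = 4 ^+ n &
      forall t, 0 < t -> K t (emb X zw.2) <= K t (emb X zw.1)].
  (* [8 ^ n = 4 ^ n / 2 ^ - n] is the ratio of the quasi-norms of the pair *)
  apply: contrapT => Nzw; apply: Nunif; exists (8 ^+ n) => x y Xx Sy yx.
  have [z _ xE] := Xx; have [w _ yE] := Xmono _ _ Xx Sy yx.
  rewrite -xE -yE in yx *; rewrite !nrmE leNgt; apply/negP => ltw.
  have w0 : 0 < qnorm w by rewrite (le_lt_trans _ ltw)// mulr_ge0 ?qnorm_ge0.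
  pose c := 4 ^+ n / qnorm w; have c0 : 0 < c by rewrite divr_gt0// exprn_gt0.
  apply: Nzw; exists (c *: z, c *: w); split=> /=.
  - rewrite qnormZ gtr0_norm// exprVn -ler_pdivlMl// invfM invrK.
    rewrite mulrC mulrCA mulrA -invfM -exprMn -natrM ler_pdivlMl ?exprn_gt0 //.
    exact/ltW.
  - by rewrite qnormZ gtr0_norm// divfK// gt_eqF.
  - move=> t t0; have Sz u := @intermediate_Sigma _ _ X u.
    by rewrite !linearZ/= !KZ ?(ltW t0)// ler_wpM2l// yx.
have [BX BX0 serX] := qnorm_geometric_series (carrier X).
have [n|x [_ _ zx]] := serX (fun n => vabs (zw n).1) 1.
  by rewrite qnorm_vabs mul1r; have [] := zwP n.
have {}zx n : vabs (zw n).1 <= vabs x.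
  by apply: le_trans (le_vabs _); apply: zx => i; exact: vabs_ge0.
have [B B0 serS] := Sigma_geometric_series XX.
pose c n : R := 2^-1 ^+ n.
have c0 n : 0 < c n by rewrite exprn_gt0// invr_gt0.
have [n|n|n t t0|y [Sy vy Ky]] :=
  serS (fun n => c n *: vabs (emb X (zw n).2)) (fun t => K t (emb X x)).
- by apply: vlattice_scale_ge0; [exact/ltW|exact: vabs_ge0].
- apply: SigmaZ; apply: (@Sigma_solid _ _ _ (emb X (zw n).2)).
    by rewrite vabs_vabs.
  exact: intermediate_Sigma.
- have t0' := ltW t0; rewrite KZ//; last first.
    apply: (@Sigma_solid _ _ _ (emb X (zw n).2)); first by rewrite vabs_vabs.
    exact: intermediate_Sigma.
  rewrite gtr0_norm// mulrC ler_pM2r//.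
  apply: (@le_trans _ _ (K t (emb X (zw n).2))).
    by apply: K_solid; rewrite ?vabs_vabs//; exact: intermediate_Sigma.
  have [_ _ zwK] := zwP n; apply: (le_trans (zwK _ t0)).
  exact: K_emb_solid.
have [|||u _ uE] := Xmono (emb X x) (B^-1 *: y).
- exact: image_dom.
- exact: SigmaZ.
- by move=> t t0; rewrite KZ ?(ltW t0)// gtr0_norm ?invr_gt0// ler_pdivrMl// Ky.
pose y' := B *: u; have y'E : emb X y' = y.
  by rewrite linearZ/= uE scalerA mulfV ?gt_eqF// scale1r.
have big n : 2 ^+ n <= qnorm y'.
  have [_ wE _] := zwP n.
  have : qnorm (c n *: (zw n).2) <= qnorm y'.
    apply: qnorm_le; apply: le_trans (le_vabs _).
    rewrite vabsZ gtr0_norm// -(hom_le (@emb_inj _ _ X) (@emb_hom _ _ X)).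
    by rewrite linearZ/= (hom_vabs (@emb_hom _ _ X)) y'E.
  rewrite qnormZ gtr0_norm// wE -exprMn.
  by have -> : 2^-1 * 4 = 2 :> R by lra.
have := big (Num.truncn (qnorm y')).+1; apply/negP; rewrite -ltNge.
apply: (lt_trans (truncnS_gt _)).
by rewrite -natrX ltr_nat ltn_expl.
Qed.

End KMonotone.

(** * K(p,q)-monotone spaces *)

Section Series.
Variable R : realType.
Implicit Types (a : nat -> R) (c : R).

Lemma le_nneseries a k : (forall i, 0 <= a i) ->
  ((\sum_(i < k) a i)%:E <= \sum_(0 <= i <oo) (a i)%:E)%E.
Proof.
move=> a0; rewrite -sumEFin -(big_mkord predT (fun i => (a i)%:E)).
by apply: nneseries_lim_ge => i _ _; rewrite lee_fin.
Qed.

Lemma nneseries_le a c : (forall i, 0 <= a i) ->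
  (forall k, \sum_(i < k) a i <= c) -> (\sum_(0 <= i <oo) (a i)%:E <= c%:E)%E.
Proof.
move=> a0 ac; apply: lime_le.
  by apply: is_cvg_nneseries => i _ _; rewrite lee_fin.
by apply: nearW => k; rewrite big_mkord sumEFin lee_fin.
Qed.

Lemma le_poweR (r : R) (x y : \bar R) : 0 <= r -> (0 <= x)%E -> (x <= y)%E ->
  (x `^ r <= y `^ r)%E.
Proof.
move=> r0 x0 xy; apply: gt0_ler_poweR => //; rewrite in_itv/= leey andbT//.
exact: le_trans xy.
Qed.

End Series.

Section Kpq.
Variables (R : realType) (XX : qblCouple R) (X : intermediate XX).
Implicit Types (z : carrier X) (p q t : R).

(** The [i]-th term is rescaled by the factor that turns the [l^p] sum of the
    [K]-functionals into a supremum; the sum of the absolute values of the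
    rescaled terms dominates each of them, hence so does its [K]-functional.
    The exponent [q] is the one for which the rescaled terms are still
    summable. *)
Lemma lp_sum_dominated p : 0 < p -> exists q B, [/\ 0 < q, q <= p, 0 < B &
  forall (z_ : nat -> carrier X) (S : R),
    (forall k, \sum_(i < k) qnorm (z_ i) `^ q <= S) ->
  exists z, qnorm z <= B * S `^ q^-1 /\
    forall t, 0 <= t -> forall k,
      \sum_(i < k) K t (emb X (z_ i)) `^ p <= K t (emb X z) `^ p].
Proof.
move=> p0; have [n [B [n0 B0 serP]]] := qnorm_series (carrier X).
have nR0 : 0 < n%:R :> R by rewrite ltr0n.
pose q := (p^-1 + n%:R)^-1.
have s0 : 0 < p^-1 + n%:R by rewrite addr_gt0// invr_gt0.
have q0 : 0 < q by rewrite invr_gt0.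
have qE : q / p + q * n%:R = 1 by rewrite -mulrDr mulVf// gt_eqF.
exists q, B; split=> //.
  by rewrite -[p]invrK lef_pV2 ?posrE ?invr_gt0// lerDl ltW.
move=> z_ S zS.
have S0 : 0 <= S by have := zS 0%N; rewrite big_ord0.
suff [z [zB Kz]] : exists z, qnorm z <= B * S `^ q^-1 /\ forall t i, 0 <= t ->
    K t (emb X (z_ i)) `^ p <= qnorm (z_ i) `^ q / S * K t (emb X z) `^ p.
  exists z; split=> // t t0 k.
  apply: (@le_trans _ _
    (\sum_(i < k) qnorm (z_ i) `^ q / S * K t (emb X z) `^ p)).
    by apply: ler_sum => i _; exact: Kz.
  rewrite -!mulr_suml -[leRHS]mul1r ler_wpM2r ?powR_ge0//.
  have [S_0|Spos] := leP S 0; last by rewrite ler_pdivrMr// mul1r.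
  by rewrite (_ : S = 0) ?invr0 ?mulr0//; apply/le_anti; rewrite S_0.
have zi0 t i : qnorm (z_ i) = 0 -> 0 <= t -> K t (emb X (z_ i)) `^ p = 0.
  move=> /qnorm0_eq0 -> t0; rewrite -(scale0r (0 : carrier X)) linearZ/= KZ//.
    by rewrite normr0 mul0r powR0// gt_eqF.
  exact: intermediate_Sigma.
have [S_0|Spos] := leP S 0.
  have {}S_0 : S = 0 by apply/le_anti; rewrite S_0.
  exists 0; rewrite qnorm0 mulr_ge0 ?powR_ge0 ?ltW//; split=> // t i t0.
  rewrite zi0// ?mulr_ge0 ?powR_ge0 ?invr_ge0//.
  apply: (@powR_eq0_eq0 _ _ q); apply/le_anti; rewrite powR_ge0 andbT -S_0.
  apply: le_trans (zS i.+1); rewrite big_ord_recr/= lerDr.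
  by apply: sumr_ge0 => j _; exact: powR_ge0.
(* the weights: the sum of the [d i `^ p] is at most [1] *)
pose d i := (qnorm (z_ i) `^ q / S) `^ p^-1.
have d0 i : 0 <= d i by exact: powR_ge0.
have dgt0 i : 0 < qnorm (z_ i) -> 0 < d i.
  by move=> zi; rewrite powR_gt0// divr_gt0// powR_gt0.
have dp i : d i `^ p = qnorm (z_ i) `^ q / S.
  rewrite -powRrM mulVf ?gt_eqF// powRr1// divr_ge0 ?powR_ge0//.
have dE i : 0 < qnorm (z_ i) ->
    d i * (S `^ p^-1 * qnorm (z_ i) `^ (q * n%:R)) = qnorm (z_ i).
  move=> zi; rewrite /d powRM ?powR_ge0 ?invr_ge0// -powRrM [S `^ _ * _]mulrC.
  rewrite mulrACA -powRD; last by apply/implyP => _; rewrite gt_eqF.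
  rewrite qE powRr1 ?ltW// -powRM ?invr_ge0// mulVf ?gt_eqF//.
  by rewrite powR1 mulr1.
have [k|z [_ zB zz]] := serP (fun i => (d i)^-1 *: vabs (z_ i))
    (S `^ (p^-1 / n%:R) * S).
  apply: (@le_trans _ _ (\sum_(i < k) S `^ (p^-1 / n%:R) * qnorm (z_ i) `^ q)).
    apply: ler_sum => i _; rewrite qnormZ qnorm_vabs ger0_norm ?invr_ge0//.
    have := qnorm_ge0 (z_ i); rewrite le_eqVlt => /orP[/eqP <-|zi].
      by rewrite mulr0 powR0 ?mulr_ge0 ?powR_ge0// invr_eq0 gt_eqF.
    rewrite -{1}(dE i zi) mulKf ?gt_eqF ?dgt0// powRM ?powR_ge0//.
    by rewrite -!powRrM mulfK// gt_eqF.
  by rewrite -mulr_sumr ler_wpM2l ?powR_ge0.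
exists z; split.
  apply: (le_trans zB); rewrite ler_wpM2l ?(ltW B0)// exprMn.
  rewrite -!powR_mulrn ?powR_ge0// -powRrM divfK ?gt_eqF//.
  rewrite -powRD; last by apply/implyP => _; rewrite gt_eqF.
  by rewrite /q invrK.
move=> t i t0; have := qnorm_ge0 (z_ i); rewrite le_eqVlt => /orP[/eqP/esym zi|zi].
  by rewrite zi0// mulr_ge0 ?powR_ge0// divr_ge0 ?powR_ge0.
have K0 z' : 0 <= K t (emb X z') by rewrite K_ge0//; exact: intermediate_Sigma.
rewrite -dp -powRM// ge0_ler_powR ?nnegrE ?mulr_ge0 ?(ltW p0)//.
rewrite -ler_pdivrMl ?dgt0//.
rewrite -[X in X * _]ger0_norm ?invr_ge0// -KZ//; last exact: intermediate_Sigma.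
rewrite -linearZ/=; apply: K_emb_solid => //; apply: le_trans (le_vabs _).
rewrite vabsZ ger0_norm ?invr_ge0//; apply: zz => j.
by apply: vlattice_scale_ge0; rewrite ?invr_ge0 ?vabs_ge0.
Qed.

Lemma uniformly_K_monotone_Kpq p : 0 < p -> uniformly_K_monotone X ->
  exists q, [/\ 0 < q, q <= p & Kpq_monotone p q X].
Proof.
move=> p0 [Xmono [C CP]]; have [q [B [q0 qp B0 domP]]] := lp_sum_dominated p0.
exists q; split=> //; exists (Num.max 1 C * B).
  by rewrite mulr_gt0// lt_max ltr01.
move=> x_ x /[dup] Xx /(_ _)/cid2-/all_sig2[z_ _ zE] xfin Sx Kx.
pose a i := nrm (space_of X) (x_ i) `^ q.
have a0 i : 0 <= a i by exact: powR_ge0.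
pose S := fine (\sum_(0 <= i <oo) (a i)%:E)%E.
have SE : (\sum_(0 <= i <oo) (a i)%:E)%E = S%:E.
  rewrite fineK// ge0_fin_numE//; apply: le_trans (le_nneseries 0 a0).
  by rewrite big_ord0.
have [k|z [zB Kz]] := domP z_ S.
  rewrite -lee_fin -SE; apply: le_trans (le_nneseries k a0).
  by rewrite lee_fin; apply: ler_sum => i _; rewrite /a -zE nrmE.
have Kxz t : 0 < t -> K t x <= K t (emb X z).
  move=> t0; rewrite -lee_fin; apply: (le_trans (Kx _ t0)).
  have Kz0 : 0 <= K t (emb X z).
    by rewrite K_ge0 ?(ltW t0)//; exact: intermediate_Sigma.
  have -> : (K t (emb X z))%:E = ((K t (emb X z) `^ p)%:E `^ p^-1)%E.
    by rewrite poweR_EFin -powRrM mulfV ?gt_eqF// powRr1.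
  apply: le_poweR; rewrite ?invr_ge0 ?(ltW p0)//.
    apply: le_trans (le_nneseries 0 _); first by rewrite big_ord0.
    by move=> i; exact: powR_ge0.
  apply: nneseries_le => [i|k]; first exact: powR_ge0.
  by under eq_bigr do rewrite -zE; exact: Kz (ltW t0) k.
have Xz := image_dom (emb X) z.
split; first exact: Xmono Xz Sx Kxz.
rewrite SE poweR_EFin -EFinM lee_fin -mulrA.
apply: (le_trans (CP _ _ Xz Sx Kxz)); rewrite nrmE.
apply: (@le_trans _ _ (Num.max 1 C * qnorm z)).
  by rewrite ler_wpM2r ?qnorm_ge0// le_max lexx orbT.
by rewrite ler_wpM2l// le_max ler01.
Qed.

Lemma Kpq_uniformly_K_monotone p q : 0 < p -> 0 < q -> Kpq_monotone p q X ->
  uniformly_K_monotone X.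
Proof.
move=> p0 q0 [C C0 CP].
suff H x y : dom (space_of X) x -> dom (Sigma XX) y ->
    (forall t, 0 < t -> K t y <= K t x) ->
    dom (space_of X) y /\ nrm (space_of X) y <= C * nrm (space_of X) x.
  by split=> [x y Xx Sy /H[]//|]; exists C => x y Xx Sy /H[].
move=> [z _ <-] Sy yz; pose z_ i : carrier X := if i is 0%N then z else 0.
have zsum : (\sum_(0 <= i <oo) (nrm (space_of X) (emb X (z_ i)) `^ q)%:E <=
    (qnorm z `^ q)%:E)%E.
  apply: nneseries_le => [i|[|k]]; rewrite ?big_ord0 ?powR_ge0//.
  rewrite big_ord_recl nrmE big1 ?addr0// => i _.
  by rewrite nrmE/= qnorm0 powR0// gt_eqF.
have [|||t t0|] := CP (emb X \o z_) y.
- by move=> i; exact: image_dom.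
- by rewrite (le_lt_trans zsum)// ltry.
- exact: Sy.
- have -> : (K t y)%:E = ((K t y `^ p)%:E `^ p^-1)%E.
    rewrite poweR_EFin -powRrM mulfV ?gt_eqF// powRr1//.
    by rewrite K_ge0 ?(ltW t0).
  have a0 i : 0 <= K t (emb X (z_ i)) `^ p by exact: powR_ge0.
  have a1 := le_nneseries 1 a0.
  have K0 : (0 <= (K t y `^ p)%:E)%E by rewrite lee_fin powR_ge0.
  have K1 : ((K t y `^ p)%:E <= \sum_(0 <= i <oo) (K t (emb X (z_ i)) `^ p)%:E)%E.
    apply: le_trans a1; rewrite big_ord1 lee_fin.
    by rewrite ge0_ler_powR ?nnegrE ?K_ge0 ?(ltW t0) ?(ltW p0)//;
      [exact: intermediate_Sigma|exact: yz].
  by apply: le_poweR; rewrite ?invr_ge0 ?(ltW p0).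
- move=> Xy yle; split=> //; rewrite nrmE -lee_fin; apply: (le_trans yle).
  rewrite EFinM lee_wpmul2l ?lee_fin ?(ltW C0)//.
  have -> : (qnorm z)%:E = ((qnorm z `^ q)%:E `^ q^-1)%E.
    by rewrite poweR_EFin -powRrM mulfV ?gt_eqF// powRr1 ?qnorm_ge0.
  have s0 : (0 <= \sum_(0 <= i <oo) (nrm (space_of X) (emb X (z_ i)) `^ q)%:E)%E.
    have a0 i : 0 <= nrm (space_of X) (emb X (z_ i)) `^ q by exact: powR_ge0.
    by apply: le_trans (le_nneseries 0 a0); rewrite big_ord0.
  by apply: le_poweR; rewrite ?invr_ge0 ?(ltW q0).
Qed.

End Kpq.

(** * Function lattices defined by majorants *)

Lemma geometric_small (R : realType) (M e : R) : 0 < e ->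
  exists m, M * 4^-1 ^+ m < e.
Proof.
move=> e0; exists (Num.truncn (M / e)).+1.
rewrite exprVn ltr_pdivrMr ?exprn_gt0// mulrC -ltr_pdivrMr//.
apply: (lt_trans (truncnS_gt _)).
by rewrite -natrX ltr_nat ltn_expl.
Qed.

Lemma cvg_of_tail_bound (R : realType) (w c : nat -> R) :
  (forall m k, `|w (m + k)%N - w m| <= c m) ->
  (forall e, 0 < e -> exists m, c m < e) ->
  exists2 l, w n @[n --> \oo] --> l & forall m, `|w m - l| <= c m.
Proof.
move=> wc c0; have : cvg (w n @[n --> \oo]).
  apply/cauchy_cvgP/cauchy_exP => e /c0[m cm]; exists (w m).
  exists m => // k /= mk; rewrite /ball/= distrC; apply: le_lt_trans cm.
  by rewrite -(subnKC mk).
move=> /cvg_ex[l wl]; exists l => // m; apply/ler_addgt0Pl => e e0.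
have /cvgrPdist_lt/(_ _ e0)[N _ NP] := wl.
have /= := NP (m + N)%N (leq_addl _ _); have := wc m N.
rewrite [`|w m - l|]distrC -(subrKA (w (m + N)%N) l (- w m)).
move=> h1 h2; apply: (le_trans (ler_normD _ _)).
by rewrite lerD// ltW.
Qed.

Section HalfLine.
Variable R : realType.
Local Notation mu := (@half_line_measure R).
Implicit Types (f g w : R -> R) (P : R -> Prop).

#[global] Instance ae_half_line_filter : Filter (nbhs (almost_everywhere mu)).
Proof. exact: (ae_filter_ringOfSetsType mu). Qed.

Lemma half_line_measure_gt0 : (0 < mu [set: R])%E.
Proof.
rewrite /half_line_measure /mrestr/= setTI /half_line.
by rewrite lebesgue_measure_itv/= ltry addye// ltry.
Qed.

Lemma ae_half_line : {ae mu, forall t, 0 < t}.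
Proof.
exists (~` (@half_line R)); split.
- by apply: measurableC; exact: measurable_half_line.
- by rewrite /half_line_measure /mrestr setICl measure0.
- by move=> t /= t0; apply: contra_not t0; rewrite /half_line/= in_itv/= andbT.
Qed.

Lemma ae_exists_between P (a b : R) : 0 <= a -> a < b ->
  {ae mu, forall t, P t} -> exists2 t, a < t < b & P t.
Proof.
move=> a0 ab [A [mA A0 PA]]; apply: contrapT => NP.
have abA : `]a, b[%classic `<=` A `&` (@half_line R).
  move=> t /=; rewrite in_itv/= => /andP[at_ tb]; split.
    by apply: PA => Pt; apply: NP; exists t; rewrite ?at_.
  by rewrite /half_line/= in_itv/= andbT (le_lt_trans a0).
have : (lebesgue_measure (`]a, b[%classic : set R) <= mu A)%E.
  rewrite /half_line_measure /mrestr; apply: le_measure => //; rewrite inE.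
    exact: measurable_itv.
  by apply: measurableI => //; exact: measurable_half_line.
rewrite A0 lebesgue_measure_itv/= lte_fin ab -EFinD lee_fin.
by rewrite leNgt subr_gt0 ab.
Qed.

Lemma Linfty_weighted_le w f (c : R) : 0 <= c ->
  measurable_fun (@half_line R) f -> {ae mu, forall t, `|f t * w t| <= c} ->
  dom (Linfty_weighted w) f /\ nrm (Linfty_weighted w) f <= c.
Proof.
move=> c0 mf fc.
have le : (Lnorm mu +oo (fun t => (f t * w t)%:E) <= c%:E)%E.
  rewrite Lnorm.unlock half_line_measure_gt0; apply/ess_supP.
  by apply: filterS fc => t /=; rewrite lee_fin.
have ge : (0 <= Lnorm mu +oo (fun t => (f t * w t)%:E))%E by exact: Lnorm_ge0.
split; first by split=> //; rewrite (le_lt_trans le)// ltry.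
by rewrite /= -lee_fin fineK// ge0_fin_numE// (le_lt_trans le)// ltry.
Qed.

Lemma Linfty_weighted_ae w f : dom (Linfty_weighted w) f ->
  {ae mu, forall t, `|f t * w t| <= nrm (Linfty_weighted w) f}.
Proof.
move=> [mf]; rewrite /=; have := @Lnorm_ge0 _ _ _ mu +oo%E (fun t => (f t * w t)%:E).
rewrite Lnorm.unlock half_line_measure_gt0 => ge fin.
apply: filterS (ess_sup_ge mu (abse \o (fun t => (f t * w t)%:E))) => t /=.
by rewrite -lee_fin fineK// ge0_fin_numE.
Qed.

Lemma Linfty_weighted_nrm_ge0 w f : 0 <= nrm (Linfty_weighted w) f.
Proof. apply: fine_ge0; exact: Lnorm_ge0. Qed.

Lemma Linfty_weightedB w f g : dom (Linfty_weighted w) f ->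
  dom (Linfty_weighted w) g -> dom (Linfty_weighted w) (f - g).
Proof.
move=> df dg; have [mf _] := df; have [mg _] := dg.
set c := nrm (Linfty_weighted w) f + nrm (Linfty_weighted w) g.
apply: (Linfty_weighted_le (c := c) _ _ _).1.
- by rewrite addr_ge0// Linfty_weighted_nrm_ge0.
- exact: measurable_funB.
- apply: filterS2 (Linfty_weighted_ae df) (Linfty_weighted_ae dg) => t hf hg.
  rewrite (_ : (f - g) t = f t - g t)// mulrBl.
  by rewrite (le_trans (ler_normB _ _))// lerD.
Qed.

End HalfLine.

(** What a family of functions [Phi i], of size [N i], must satisfy for the
    functions dominated by one of them to form an intermediate quasi-Banach
    function lattice.  The last condition yields both the quasi-triangle
    inequality and completeness.  The families of interest are the
    [K]-functionals of the elements of a space and, for spaces on which the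
    [K]-functional vanishes, the multiples of [min(1, t)]. *)
Record majorants (R : realType) (I : Type) (Phi : I -> R -> R) (N : I -> R) :
    Prop := {
  majorant_size_ge0 : forall i, 0 <= N i ;
  majorant_ge0 : forall i t, 0 < t -> 0 <= Phi i t ;
  majorant_scale : forall c i, 0 <= c -> exists2 j, N j <= c * N i &
    forall t, 0 < t -> c * Phi i t <= Phi j t ;
  majorant_bound : exists2 D, 0 < D &
    forall i t, 0 < t -> Phi i t <= D * N i * Num.max 1 t ;
  majorant_min : exists i, forall t, 0 < t -> Num.min 1 t <= Phi i t ;
  majorant_sum : exists2 D, 0 < D & forall (s : R) (i_ : nat -> I),
    (forall k, N (i_ k) <= s * 4^-1 ^+ k) -> exists2 j, N j <= D * s &
    forall n t, 0 < t -> \sum_(k < n) Phi (i_ k) t <= Phi j t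
}.

Section MajorizedFunctions.
Variables (R : realType) (I : Type) (Phi : I -> R -> R) (N : I -> R).
Hypothesis M : majorants Phi N.
Local Notation mu := (@half_line_measure R).
Implicit Types (f g : R -> R) (i j : I) (c e t : R).

Definition majorized f i := ae_le (fun t => `|f t|) (Phi i).

Definition majorized_space : nspace R (R -> R) :=
  NSpace [set f | measurable_fun (@half_line R) f /\ exists i, majorized f i]
    (fun f => inf [set N i | i in majorized f]).

Local Notation E := majorized_space.

Let N0 i : 0 <= N i. Proof. exact: majorant_size_ge0 M i. Qed.

Let sizes_lb f : lbound [set N i | i in majorized f] 0.
Proof. by move=> _ [i _ <-]. Qed.

Let sizes_inf f : dom E f -> has_inf [set N i | i in majorized f].
Proof.
by move=> [_ [i fi]]; split; [exists (N i), i|exists 0; exact: sizes_lb].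
Qed.

Lemma majorized_nrm_le f i : majorized f i -> nrm E f <= N i.
Proof. by move=> fi; apply: ge_inf; [exists 0; exact: sizes_lb|exists i]. Qed.

Lemma majorized_nrm_lt f c : dom E f -> nrm E f < c ->
  exists2 i, majorized f i & N i < c.
Proof.
move=> Ef fc; have c0 : 0 < c - nrm E f by rewrite subr_gt0.
have [_ [i fi <-] lt] := inf_adherent c0 (sizes_inf Ef).
by exists i => //; rewrite addrC subrK in lt.
Qed.

Lemma le_majorized_nrm f c : dom E f -> (forall i, majorized f i -> c <= N i) ->
  c <= nrm E f.
Proof.
move=> Ef cP; apply: lb_le_inf; first exact: (sizes_inf Ef).1.
by move=> _ [i fi <-]; exact: cP.
Qed.

Lemma majorized_nrm_ge0 f : dom E f -> 0 <= nrm E f.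
Proof. by move=> Ef; apply: le_majorized_nrm. Qed.

Lemma majorizedZ c f i : majorized f i ->
  exists2 j, N j <= `|c| * N i & majorized (c *: f) j.
Proof.
move=> fi; have [j Nj Phij] := majorant_scale M i (normr_ge0 c).
exists j => //; apply: filterS2 (@ae_half_line R) fi => t t0 fit.
rewrite (_ : (c *: f) t = c * f t)// normrM.
by rewrite (le_trans _ (Phij _ t0))// ler_wpM2l.
Qed.

Let null_index : exists2 i, N i = 0 & forall t, 0 < t -> 0 <= Phi i t.
Proof.
have [i0 _] := majorant_min M; have [i Ni _] := majorant_scale M i0 (lexx 0).
exists i; last by move=> t; exact: majorant_ge0 M _ _.
by apply/le_anti; rewrite N0 andbT; rewrite mul0r in Ni.
Qed.

Lemma majorizedD : exists2 C : R, 0 < C & forall f g i j,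
  majorized f i -> majorized g j ->
  exists2 k, N k <= C * (N i + N j) & majorized (f + g) k.
Proof.
have [D D0 sumP] := majorant_sum M; have [i0 Ni0 Phii0] := null_index.
exists (D * 4); first exact: mulr_gt0.
move=> f g i j fi gj.
pose i_ k := if k is 0%N then i else if k is 1%N then j else i0.
have [k|k Nk Phik] := sumP (4 * (N i + N j)) i_.
  have Ni := N0 i; have Nj := N0 j; case: k => [|[|k]] /=.
  - by rewrite expr0; lra.
  - by rewrite expr1; lra.
  - by rewrite Ni0 mulr_ge0 ?exprn_ge0 ?mulr_ge0 ?addr_ge0.
exists k; first by rewrite -mulrA.
have fgj : {ae mu, forall t, `|f t| <= Phi i t /\ `|g t| <= Phi j t}.
  by apply: filterS2 fi gj => t.
apply: filterS2 (@ae_half_line R) fgj => t t0 [hf hg].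
have := Phik 2%N t t0; rewrite !big_ord_recl big_ord0 addr0/=; apply: le_trans.
by rewrite (le_trans (ler_normD _ _))// lerD.
Qed.

Lemma majorized_dom_add f g : dom E f -> dom E g -> dom E (f + g).
Proof.
move=> [mf [i fi]] [mg [j gj]]; split; first exact: measurable_funD.
have [C _ CP] := majorizedD.
by have [k _ fgk] := CP _ _ _ _ fi gj; exists k.
Qed.

Lemma majorized_dom_scale c f : dom E f -> dom E (c *: f).
Proof.
move=> [mf [i fi]]; split; first by
  apply: measurable_funM => //; exact: measurable_cst.
by have [j _ fj] := majorizedZ c fi; exists j.
Qed.

Lemma majorized_dom_sub f g : dom E f -> dom E g -> dom E (f - g).
Proof.
by move=> Ef Eg; rewrite -scaleN1r; apply/majorized_dom_add/majorized_dom_scale.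
Qed.

Lemma majorized_nrmD : exists2 C : R, 0 < C & forall f g, dom E f -> dom E g ->
  nrm E (f + g) <= C * (nrm E f + nrm E g).
Proof.
have [C C0 CP] := majorizedD; exists C => // f g Ef Eg.
apply/ler_addgt0Pl => e e0.
have d0 : 0 < e / C / 2 by rewrite !divr_gt0.
have [i fi lti] := majorized_nrm_lt Ef (ltr_pwDr d0 (lexx (nrm E f))).
have [j gj ltj] := majorized_nrm_lt Eg (ltr_pwDr d0 (lexx (nrm E g))).
have [k Nk fgk] := CP _ _ _ _ fi gj.
apply: (le_trans (majorized_nrm_le fgk)); apply: (le_trans Nk).
have eE : e / C / 2 * 2 * C = e by rewrite !divfK// gt_eqF.
have := ler_wpM2l (ltW C0) (ltW (ltrD lti ltj)).
by rewrite -[in X in _ -> X]eE; lra.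
Qed.

Lemma majorized_nrmZ c f : dom E f -> nrm E (c *: f) = `|c| * nrm E f.
Proof.
have le d g : dom E g -> d != 0 -> nrm E (d *: g) <= `|d| * nrm E g.
  move=> Eg d0; rewrite -ler_pdivrMl ?normr_gt0//.
  apply: le_majorized_nrm => // i /(majorizedZ d)[j Nj fj].
  by rewrite ler_pdivrMl ?normr_gt0// (le_trans (majorized_nrm_le fj)).
move=> Ef; have [->|c0] := eqVneq c 0.
  have [_ [i fi]] := Ef.
  have [j Nj fj] := majorizedZ 0 fi.
  rewrite normr0 [0 * nrm E f]mul0r; rewrite normr0 mul0r in Nj.
  apply/le_anti/andP; split.
    exact: le_trans (majorized_nrm_le fj) Nj.
  exact/majorized_nrm_ge0/majorized_dom_scale.
apply/le_anti; rewrite le//= -ler_pdivlMl ?normr_gt0// -normfV.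
rewrite -{1}[f]scale1r -(mulVf c0) -scalerA le ?invr_eq0//.
exact: majorized_dom_scale.
Qed.

Lemma majorized_nrm_eq0 f : dom E f -> nrm E f = 0 -> {ae mu, forall t, f t = 0}.
Proof.
move=> Ef f0; have [D D0 DP] := majorant_bound M.
have small n : {ae mu, forall t, `|f t| <= D * 4^-1 ^+ n * Num.max 1 t}.
  have [|i fi Ni] := @majorized_nrm_lt f (4^-1 ^+ n) Ef.
    by rewrite f0 exprn_gt0.
  apply: filterS2 (@ae_half_line R) fi => t t0 fit.
  rewrite (le_trans fit)// (le_trans (DP i t t0))//.
  by rewrite ler_wpM2r ?le_max ?ler01// ler_pM2l// ltW.
apply: filterS (ae_foralln small) => t ft; apply/eqP; rewrite -normr_le0.
rewrite leNgt; apply/negP => ft0.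
have [n] := geometric_small (D * Num.max 1 t) ft0.
by rewrite mulrAC ltNge ft.
Qed.

Lemma majorized_solid f g : measurable_fun (@half_line R) f -> dom E g ->
  ae_le (fun t => `|f t|) (fun t => `|g t|) -> dom E f /\ nrm E f <= nrm E g.
Proof.
move=> mf Eg fg.
have le i : majorized g i -> majorized f i.
  by move=> gi; apply: filterS2 fg gi => t; exact: le_trans.
split; last by apply: le_majorized_nrm => // i /le/majorized_nrm_le.
by split=> //; have [_ [i /le fi]] := Eg; exists i.
Qed.

(** Along a subsequence with rapidly decreasing increments, the [m]-th tail of
    the series of increments has a single majorant, of size proportional to
    [4 ^ - m]; this gives the pointwise limit, and bounds its distance to the
    [m]-th term in the norm of the space. *)
Lemma majorized_complete (u : nat -> R -> R) : (forall n, dom E (u n)) ->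
  (forall e, 0 < e -> exists k : nat, forall m n : nat,
    (k <= m)%N -> (k <= n)%N -> nrm E (u m - u n) < e) ->
  exists2 l, dom E l & forall e, 0 < e -> exists k : nat, forall n : nat,
    (k <= n)%N -> nrm E (u n - l) < e.
Proof.
move=> Eu uC; pose p m : R := 4^-1 ^+ m.
have p0 m : 0 < p m by rewrite exprn_gt0.
have /choice[k_ kP] m := uC _ (p0 m).
(* partial sums of the [k_ j], to make the indices of the subsequence monotone *)
pose n_ m := (\sum_(j < m.+1) k_ j)%N.
have kn m : (k_ m <= n_ m)%N by rewrite /n_ big_ord_recr leq_addl.
have nS m : (n_ m <= n_ m.+1)%N by rewrite {2}/n_ big_ord_recr leq_addr.
pose w m := u (n_ m); pose v m := w m.+1 - w m.
have /choice[i_ iP] m : exists i, majorized (v m) i /\ N i < p m.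
  have [||i vi Ni] := @majorized_nrm_lt (v m) (p m).
  - exact: majorized_dom_sub (Eu _) (Eu _).
  - by apply: kP => //; apply: leq_trans (nS m).
  - by exists i.
have [D D0 sumP] := majorant_sum M.
have /choice[j_ jP] m : exists j, N j <= D * p m /\
    forall n t, 0 < t -> \sum_(k < n) Phi (i_ (m + k)%N) t <= Phi j t.
  have [k|j Nj jP] := sumP (p m) (fun k => i_ (m + k)%N); last by exists j.
  by rewrite /p -exprD; apply/ltW; exact: (iP _).2.
have : {ae mu, forall t, 0 < t /\ forall m, `|v m t| <= Phi (i_ m) t}.
  have := ae_foralln (fun m => (iP m).1).
  by apply: filterS2 (@ae_half_line R) => t.
move=> [A [mA A0 AP]].
have good t : ~ A t -> 0 < t /\ forall m, `|v m t| <= Phi (i_ m) t.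
  by move=> At; apply: contrapT => Nt; apply/At/AP.
have tail t m k : ~ A t -> `|w (m + k)%N t - w m t| <= Phi (j_ m) t.
  move=> /good[t0 vt]; apply: le_trans ((jP m).2 k t t0).
  elim: k => [|k IH]; first by rewrite addn0 subrr normr0 big_ord0.
  rewrite big_ord_recr/= addnS -(subrKA (w (m + k)%N t)) addrC.
  by rewrite (le_trans (ler_normD _ _))// lerD//; exact: vt.
have [D' D'0 boundP] := majorant_bound M.
(* cutting the [w m] off on the null set [A] makes them converge everywhere,
   so that the limit is measurable *)
have /choice[l lP] t : exists l, ((w m t * \1_(~` A) t) @[m --> \oo] --> l) /\
    (~ A t -> forall m, `|w m t - l| <= Phi (j_ m) t).
  have [At|At] := pselect (A t).
    exists 0; split=> //; under eq_fun.
      by move=> m; rewrite indicE memNset ?mulr0; [over|exact].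
    exact: cvg_cst.
  have [||l wl lm] := @cvg_of_tail_bound R (fun m => w m t) (fun m => Phi (j_ m) t).
  - by move=> m k; exact: tail.
  - move=> e e0; have [m mP] := geometric_small (D' * D * Num.max 1 t) e0.
    have [t0 _] := good t At.
    exists m; apply: le_lt_trans mP; apply: (le_trans (boundP _ _ t0)).
    rewrite [leRHS]mulrAC -[D' * D * _]mulrA ler_wpM2r ?le_max ?ler01//.
    by rewrite ler_wpM2l ?(ltW D'0)//; exact: (jP m).1.
  - exists l; split=> //; under eq_fun.
      by move=> m; rewrite indicE mem_set ?mulr1; [over|exact].
    exact: wl.
have mw m : measurable_fun (@half_line R) (w m) by have [] := Eu (n_ m).
have ml : measurable_fun (@half_line R) l.
  apply: (measurable_fun_cvg (h := fun m t => w m t * \1_(~` A) t)) => [m|t _].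
    apply: measurable_funM => //.
    by apply: measurable_indic; exact: measurableC.
  exact: (lP t).1.
have wlj m : majorized (w m - l) (j_ m).
  exists A; split=> // t; apply: contra_notP => At; exact: (lP t).2.
have Ewl m : dom E (w m - l).
  by split; [exact: measurable_funB|exists (j_ m)].
have El : dom E l.
  have -> : l = w 0%N - (w 0%N - l) by rewrite opprB addrC subrK.
  exact: majorized_dom_sub (Eu _) (Ewl _).
exists l => // e e0; have [C C0 CP] := majorized_nrmD.
have [m mP] := geometric_small (C * (1 + D)) e0.
exists (k_ m) => n kmn.
rewrite -(subrKA (w m)); apply: (le_lt_trans (CP _ _ _ (Ewl m))).
  exact: majorized_dom_sub (Eu _) (Eu _).
apply: le_lt_trans mP; rewrite -mulrA ler_wpM2l ?(ltW C0)// mulrDl mul1r.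
apply: lerD; first by apply/ltW/kP.
by apply: (le_trans (majorized_nrm_le (wlj m))); exact: (jP m).1.
Qed.

Lemma majorized_quasi_banach : quasi_banach_function_lattice E.
Proof.
have E0 : dom E 0.
  split; first exact: measurable_cst.
  have [i _ Phi0] := null_index; exists i.
  by apply: filterS (@ae_half_line R) => t /Phi0; rewrite normr0.
have [C _ CP] := majorized_nrmD.
split=> //.
- by move=> f [].
- exact: majorized_dom_add.
- exact: majorized_dom_scale.
- exact: majorized_solid.
- exact: majorized_nrm_ge0.
- exact: majorized_nrm_eq0.
- exact: majorized_nrmZ.
- by exists C.
- exact: majorized_complete.
Qed.

Let weight1 f t : `|f t * (fun=> 1 : R) t| = `|f t|.
Proof. by rewrite mulr1. Qed.

(** A function in both spaces is at most a multiple of [min(1, t)]. *)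
Lemma Delta_Linfty_majorized :
  continuous_inclusion (inter_space (@Linfty R) (@Linfty_inv R)) E.
Proof.
have [i0 i0P] := majorant_min M.
have bound f : dom (inter_space (@Linfty R) (@Linfty_inv R)) f -> exists2 i,
    N i <= nrm (inter_space (@Linfty R) (@Linfty_inv R)) f * N i0 & majorized f i.
  move=> [f0 f1]; set c := nrm _ _.
  have c0 : 0 <= c by rewrite le_max Linfty_weighted_nrm_ge0.
  have [i Ni iP] := majorant_scale M i0 c0; exists i => //.
  have fc : {ae mu, forall t, `|f t * 1| <= c /\ `|f t * t^-1| <= c}.
    apply: filterS2 (Linfty_weighted_ae f0) (Linfty_weighted_ae f1) => t h0 h1.
    by split; [apply: (le_trans h0)|apply: (le_trans h1)]; rewrite le_max lexx ?orbT.
  apply: filterS2 (@ae_half_line R) fc => t t0 [h0 h1].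
  rewrite (le_trans _ (iP t t0))// (le_trans _ (ler_wpM2l c0 (i0P t t0)))//.
  rewrite minr_pMr// mulr1 le_min; apply/andP; split; first by rewrite mulr1 in h0.
  by rewrite -ler_pdivrMr// -[X in _ / X]gtr0_norm// -normfV -normrM.
split=> [f /[dup] df [[mf _] _]|f [f0 f1] e e0].
  by split=> //; have [i _ fi] := bound f df; exists i.
exists (e / (N i0 + 1)); first by rewrite divr_gt0// ltr_wpDl.
move=> g [g0 g1] lt.
have [|i Ni fi] := bound (g - f); first by split; exact: Linfty_weightedB.
apply: (le_lt_trans (majorized_nrm_le fi)); apply: (le_lt_trans Ni).
move: lt; rewrite ltr_pdivlMr ?ltr_wpDl//; apply: le_lt_trans.
apply: ler_wpM2l; last by rewrite lerDl.
by rewrite le_max Linfty_weighted_nrm_ge0.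
Qed.

(** A function that is at most a multiple of [max(1, t)] is split at [1]. *)
Lemma majorized_Sigma_Linfty :
  continuous_inclusion E (sum_space (@Linfty R) (@Linfty_inv R)).
Proof.
have [D D0 DP] := majorant_bound M.
pose A : set R := `]-oo, 1]%classic.
have mA : measurable A by exact: measurable_itv.
have bound f i : measurable_fun (@half_line R) f -> majorized f i ->
    exists ab, [/\ decompositions (@Linfty R) (@Linfty_inv R) f ab,
      nrm (@Linfty R) ab.1 <= D * N i & nrm (@Linfty_inv R) ab.2 <= D * N i].
  move=> mf fi; have c0 : 0 <= D * N i by rewrite mulr_ge0// ltW.
  have fb : {ae mu, forall t, 0 < t /\ `|f t| <= D * N i * Num.max 1 t}.
    apply: filterS2 (@ae_half_line R) fi => t t0 h; split=> //.
    exact: le_trans h (DP i t t0).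
  have [||d0 n0] := @Linfty_weighted_le R (fun=> 1) (fun t => f t * \1_A t) _ c0.
  - by apply: measurable_funM => //; exact: measurable_indic.
  - apply: filterS fb => t [t0 ft]; rewrite mulr1 indicE.
    case: (boolP (t \in A)) => [|_]; last by rewrite mulr0 normr0.
    rewrite inE /A/= in_itv/= => t1; rewrite mulr1 (le_trans ft)//.
    by rewrite max_l// mulr1.
  have [||d1 n1] := @Linfty_weighted_le R (fun t => t^-1)
    (fun t => f t * \1_(~` A) t) _ c0.
  - by apply: measurable_funM => //; apply: measurable_indic; exact: measurableC.
  - apply: filterS fb => t [t0 ft]; rewrite indicE.
    case: (boolP (t \in ~` A)) => [|_]; last by rewrite mulr0 mul0r normr0.
    rewrite inE /A/= in_itv/= => /negP; rewrite -ltNge => t1.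
    rewrite mulr1 normrM normfV [`|t|]gtr0_norm// ler_pdivrMr//.
    by rewrite (le_trans ft)// max_r// ltW.
  exists (fun t => f t * \1_A t, fun t => f t * \1_(~` A) t); split=> //; split=> //=.
  apply/funext => t; rewrite (_ : (_ + _) t = f t * \1_A t + f t * \1_(~` A) t)//.
  rewrite -mulrDr !indicE in_setC; case: (t \in A) => /=.
    by rewrite addr0 mulr1.
  by rewrite add0r mulr1.
split=> [f [mf [i fi]]|f Ef e e0].
  by have [ab [abP _ _]] := bound f i mf fi; exists ab.
have d0 : 0 < e / (2 * D) by rewrite divr_gt0// mulr_gt0.
exists (e / (2 * D)) => // g Eg.
have Egf := majorized_dom_sub Eg Ef; have [mgf _] := Egf.
move=> /(majorized_nrm_lt Egf)[i gfi Ni].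
have [ab [abP h0 h1]] := bound _ i mgf gfi.
apply: (@le_lt_trans _ _ (nrm (@Linfty R) ab.1 + nrm (@Linfty_inv R) ab.2)).
  apply: ge_inf; last by exists ab.
  by exists 0 => _ [cd _ <-]; rewrite addr_ge0// Linfty_weighted_nrm_ge0.
move: Ni; rewrite ltr_pdivlMr ?mulr_gt0//; apply: le_lt_trans.
by lra.
Qed.

Lemma majorized_intermediate : Linfty_intermediate E.
Proof.
split; [exact: majorized_quasi_banach|exact: Delta_Linfty_majorized|].
exact: majorized_Sigma_Linfty.
Qed.

End MajorizedFunctions.

(** * K-spaces *)

Section KFunctions.
Variables (R : realType) (XX : qblCouple R).
Implicit Types (v : ambient XX) (t : R).

Lemma K_le_max v t : 0 < t -> dom (Sigma XX) v -> K t v <= Num.max 1 t * K 1 v.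
Proof.
move=> t0 Sv; have [t1|/ltW t1] := leP t 1.
  by rewrite mul1r K_homo ?(ltW t0).
by rewrite -[K t v]mul1r K_scale_homo.
Qed.

Lemma K_ge_min v t : 0 < t -> dom (Sigma XX) v -> Num.min 1 t * K 1 v <= K t v.
Proof.
move=> t0 Sv; have [t1|/ltW t1] := leP 1 t; first by rewrite mul1r K_homo ?ler01.
by rewrite -[K t v]mul1r K_scale_homo.
Qed.

Lemma K_eq0 v t : dom (Sigma XX) v -> K 1 v <= 0 -> 0 < t -> K t v = 0.
Proof.
move=> Sv v0 t0; apply/le_anti; rewrite (K_ge0 (ltW t0) Sv) andbT.
by rewrite (le_trans (K_le_max t0 Sv))// mulr_ge0_le0// le_max ler01.
Qed.

Lemma measurable_K v : dom (Sigma XX) v ->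
  measurable_fun (@half_line R) (fun t => K t v).
Proof.
move=> Sv; apply: (eq_measurable_fun (fun t => K (Num.max 0 t) v)).
  by move=> t; rewrite inE /half_line/= in_itv/= andbT => /ltW/max_r ->.
apply: nondecreasing_measurable; first exact: measurable_half_line.
move=> s t st; apply: K_homo => //; first by rewrite le_max lexx.
by rewrite ge_max !le_max lexx st orbT.
Qed.

(** Since the [K]-functional is nondecreasing, an almost everywhere inequality
    at a point between [t] and [2 * t] gives one at [t]. *)
Lemma ae_K_le v (phi : R -> R) :
  (forall t s, 0 < t -> t <= s <= 2 * t -> phi s <= 2 * phi t) ->
  dom (Sigma XX) v ->
  ae_le (fun t => `|K t v|) phi -> forall t, 0 < t -> K t v <= 2 * phi t.
Proof.
move=> phi2 Sv Kphi t t0.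
have [|s /andP[ts s2] Ks] := ae_exists_between (b := 2 * t) (ltW t0) _ Kphi.
  by lra.
apply: le_trans (phi2 _ s t0 _); last by rewrite !ltW.
apply: le_trans (le_trans (ler_norm _) Ks); apply: K_homo => //; exact: ltW.
Qed.

End KFunctions.

Lemma sum_half_powers_le2 (R : realType) n : \sum_(k < n) (2^-1 : R) ^+ k <= 2.
Proof.
suff -> : \sum_(k < n) (2^-1 : R) ^+ k = 2 - 2 * 2^-1 ^+ n.
  by rewrite gerBl mulr_ge0// exprn_ge0 ?invr_ge0.
elim: n => [|n IH]; first by rewrite big_ord0 expr0; lra.
by rewrite big_ord_recr/= IH exprS; lra.
Qed.

Section IntK.
Variables (R : realType) (XX : qblCouple R) (X : intermediate XX).
Implicit Types (z : carrier X) (t : R).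

Lemma IntK_uniformly_K_monotone : IntK XX X -> uniformly_K_monotone X.
Proof.
move=> [E [qbE _ _] [domE [c [C [c0 C0 nrmXE]]]]].
suff H x y : dom (space_of X) x -> dom (Sigma XX) y ->
    (forall t, 0 < t -> K t y <= K t x) ->
    dom (space_of X) y /\ nrm (space_of X) y <= c^-1 * C * nrm (space_of X) x.
  by split=> [x y Xx Sy /H[]//|]; exists (c^-1 * C) => x y Xx Sy /H[].
move=> Xx Sy yx; have := Xx; rewrite domE => -[Sx Ex].
have [||Ey nyx] := qbfl_solid qbE (f := fun t => K t y) _ Ex.
- exact: measurable_K.
- apply: filterS (@ae_half_line R) => t t0.
  by rewrite !ger0_norm ?K_ge0 ?(ltW t0)// yx.
have Xy : dom (space_of X) y by rewrite domE.
split=> //; rewrite -mulrA ler_pdivlMl//.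
have /andP[+ _] := nrmXE _ Xy; move=> /le_trans; apply.
apply: (le_trans nyx).
by have /andP[] := nrmXE _ Xx.
Qed.

(** The last two hypotheses say that having a [K]-functional dominated by the
    family is the same as being in [X]; the doubling condition is there because
    domination in a function lattice only holds almost everywhere. *)
Lemma majorants_IntK (I : Type) (Phi : I -> R -> R) (N : I -> R) :
  majorants Phi N ->
  (forall i t s, 0 < t -> t <= s <= 2 * t -> Phi i s <= 2 * Phi i t) ->
  (exists2 C : R, 0 < C & forall z, exists2 i, N i <= C * qnorm z &
    forall t, 0 < t -> K t (emb X z) <= Phi i t) ->
  (exists2 C : R, 0 < C & forall i x, dom (Sigma XX) x ->
    (forall t, 0 < t -> K t x <= 2 * Phi i t) ->
    exists2 z, emb X z = x & qnorm z <= C * N i) ->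
  IntK XX X.
Proof.
move=> M Phi2 [C1 C10 C1P] [C2 C20 C2P].
pose E := majorized_space Phi N.
exists E; first exact: majorized_intermediate.
have EK z : exists2 i, N i <= C1 * qnorm z & majorized Phi (fun t => K t (emb X z)) i.
  have [i Ni iP] := C1P z; exists i => //.
  apply: filterS (@ae_half_line R) => t t0.
  by rewrite ger0_norm ?iP// K_ge0 ?(ltW t0)//; exact: intermediate_Sigma.
have KX x i : dom (Sigma XX) x -> majorized Phi (fun t => K t x) i ->
    exists2 z, emb X z = x & qnorm z <= C2 * N i.
  by move=> Sx Ex; apply: C2P => //; apply: ae_K_le => //; exact: Phi2.
split.
  apply/seteqP; split=> [_ [z _ <-]|x [Sx [_ [i Ei]]]].
    have [i _ zi] := EK z; have Sz := intermediate_Sigma z.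
    by split=> //; split; [exact: measurable_K|exists i].
  by have [z <- _] := KX _ _ Sx Ei; exact: image_dom.
exists C2^-1, C1; split; rewrite ?invr_gt0// => _ [z _ <-].
have Sz := intermediate_Sigma z; rewrite nrmE.
have [i Ni zi] := EK z.
rewrite ler_pdivrMl//; apply/andP; split.
  rewrite -ler_pdivrMl//; apply: le_majorized_nrm.
  - exact: M.
  - by split; [exact: measurable_K|exists i].
  - move=> j /(KX _ _ Sz)[w /emb_inj -> wj].
    by rewrite ler_pdivrMl.
by apply: le_trans Ni; exact: (majorized_nrm_le M).
Qed.

(** Comparing its near-optimal decompositions for small and for large [t], an
    element whose [K]-functional is [O(min(1, t))] is in the intersection of the
    couple up to elements with arbitrarily small [K]-functional, and the
    intersection is contained in [X]. *)
Lemma K_min_bounded c x : (forall z, K 1 (emb X z) <= 0) -> 0 <= c ->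
  dom (Sigma XX) x -> (forall t, 0 < t -> K t x <= c * Num.min 1 t) ->
  K 1 x <= 0.
Proof.
move=> X0 c0 Sx Kx; have [C C1 CD] := K_quasi_triangle XX.
have Cpos : 0 < C by lra.
apply/ler_addgt0Pl => e e0; rewrite addr0.
pose M := C * (C + 1) * (c + 1).
have Mpos : 0 < M by rewrite !mulr_gt0; lra.
pose s := e / M; have s0 : 0 < s by rewrite divr_gt0.
(* decompositions at [s] and [s^-1]; the difference of their components in one
   space is in the intersection *)
have [a [b [xE lt1]]] := K_decomp (ltW s0) Sx s0.
have T0 : 0 < s^-1 by rewrite invr_gt0.
have [a' [b' [xE' lt2]]] := K_decomp (ltW T0) Sx ltr01.
have {}lt1 : qnorm a <= (c + 1) * s.
  have h := Kx _ s0; have : c * Num.min 1 s <= c * s.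
    by rewrite ler_wpM2l// ge_min lexx orbT.
  have : 0 <= s * qnorm b by rewrite mulr_ge0 ?qnorm_ge0 ?(ltW s0).
  by move: lt1; lra.
have {}lt2 : qnorm b' <= (c + 1) * s.
  have h := Kx _ T0; have h' : c * Num.min 1 s^-1 <= c * 1.
    by rewrite ler_wpM2l// ge_min lexx.
  rewrite -ler_pdivrMr// mulrC; have := qnorm_ge0 a'.
  by move: lt2; lra.
have uE : emb0 XX (a' - a) = emb1 XX (b - b').
  rewrite !linearB; apply/eqP; rewrite subr_eq addrAC eq_sym subr_eq.
  by rewrite [_ + emb0 XX a]addrC -xE -xE'.
have [z _ zE] : dom (space_of X) (emb0 XX (a' - a)).
  by apply: (Delta_cont X).1; split; [exists (a' - a)|exists (b - b')].
have xzE : x = emb0 XX a + emb X z + emb1 XX b'.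
  by rewrite zE linearB addrC [emb0 XX a + _]addrC subrK addrC.
have Sa : dom (Sigma XX) (emb0 XX a).
  by apply/SigmaP; exists a, 0; rewrite linear0 addr0.
have Sb : dom (Sigma XX) (emb1 XX b').
  by apply/SigmaP; exists 0, b'; rewrite linear0 add0r.
have Sz := intermediate_Sigma z.
have Ka : K 1 (emb0 XX a) <= (c + 1) * s.
  apply: le_trans lt1; have := K_le a 0 (ler01 : 0 <= 1 :> R).
  by rewrite linear0 addr0 qnorm0 mulr0 addr0.
have Kb : K 1 (emb1 XX b') <= (c + 1) * s.
  apply: le_trans lt2; have := K_le 0 b' (ler01 : 0 <= 1 :> R).
  by rewrite linear0 add0r qnorm0 mul1r add0r.
rewrite xzE (le_trans (CD _ _ _ ler01 (SigmaD Sa Sz) Sb))//.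
have hD := CD _ _ _ ler01 Sa Sz.
have eE : e = C * (C * ((c + 1) * s) + (c + 1) * s).
  rewrite -[e](divfK (lt0r_neq0 Mpos)) -/s /M; lra.
rewrite eE ler_wpM2l ?(ltW Cpos)// lerD// (le_trans hD)// ler_wpM2l ?(ltW Cpos)//.
by have := X0 z; move: Ka; lra.
Qed.

(** For the summation condition, [z] is the sum of the [2 ^ k `|z_k|]; each
    [K t z_k] is then at most [2 ^ - k * K t z].  The element with nonzero
    [K]-functional provides the majorant of [min(1, t)]. *)
Lemma K_majorants : (exists z, 0 < K 1 (emb X z)) ->
  majorants (fun z t => K t (emb X z)) (@qnorm R (carrier X)).
Proof.
have Sz z := intermediate_Sigma z.
move=> [z0 z0pos]; split.
- exact: qnorm_ge0.
- by move=> z t t0; rewrite K_ge0 ?(ltW t0).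
- move=> c z c0; exists (c *: z); first by rewrite qnormZ ger0_norm.
  by move=> t t0; rewrite linearZ/= KZ ?(ltW t0)// ger0_norm.
- have [D D0 DP] := K_bound X; exists D => // z t t0.
  rewrite (le_trans (K_le_max t0 (Sz z)))// mulrC ler_wpM2r ?le_max ?ler01//.
- exists ((K 1 (emb X z0))^-1 *: z0) => t t0.
  rewrite linearZ/= KZ ?(ltW t0)// gtr0_norm ?invr_gt0// ler_pdivlMl// mulrC.
  exact: K_ge_min.
- have [B B0 serP] := qnorm_geometric_series (carrier X).
  exists (2 * B); first exact: mulr_gt0.
  move=> s z_ z_s.
  have [k|z [_ zB zz]] := serP (fun k => 2 ^+ k *: vabs (z_ k)) s.
    rewrite qnormZ qnorm_vabs gtr0_norm ?exprn_gt0// exprVn mulrC.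
    rewrite -ler_pdivlMr ?exprn_gt0// -mulrA -invfM -exprMn -natrM -exprVn.
    exact: z_s.
  exists (2 *: z); first by rewrite qnormZ gtr0_norm// -mulrA ler_pM2l.
  move=> n t t0; have t0' := ltW t0.
  apply: (@le_trans _ _ (\sum_(k < n) 2^-1 ^+ k * K t (emb X z))).
    apply: ler_sum => k _; rewrite exprVn ler_pdivlMl ?exprn_gt0//.
    rewrite -[X in X * _]gtr0_norm ?exprn_gt0// -KZ// -linearZ.
    apply: K_emb_solid => //; rewrite vabsZ gtr0_norm ?exprn_gt0//.
    apply: le_trans (le_vabs _); apply: zz => i.
    by apply: vlattice_scale_ge0; rewrite ?exprn_ge0 ?vabs_ge0.
  rewrite -mulr_suml linearZ/= KZ// gtr0_norm// ler_wpM2r ?K_ge0//.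
  exact: sum_half_powers_le2.
Qed.

Lemma min_majorants :
  majorants (fun c t : R => `|c| * Num.min 1 t) (fun c : R => `|c|).
Proof.
have m0 t : 0 < t -> 0 <= Num.min 1 t by move=> t0; rewrite le_min ler01 ltW.
split=> //.
- by move=> c t /m0 t0; rewrite mulr_ge0.
- move=> c d c0; exists (c * d); first by rewrite normrM ger0_norm.
  by move=> t _; rewrite normrM ger0_norm// mulrA.
- exists 1 => // c t t0; rewrite mul1r ler_wpM2l//.
  by rewrite (@le_trans _ _ 1)// ?ge_min ?le_max lexx.
- by exists 1 => t _; rewrite normr1 mul1r.
- exists 2 => // s c_ c_s; have s0 : 0 <= s.
    by have := c_s 0%N; rewrite expr0 mulr1; exact: le_trans.
  exists (2 * s); first by rewrite ger0_norm// mulr_ge0.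
  move=> n t /m0 t0; rewrite -mulr_suml ler_wpM2r// ger0_norm ?mulr_ge0//.
  apply: (@le_trans _ _ (\sum_(k < n) s * 2^-1 ^+ k)).
    apply: ler_sum => k _; rewrite (le_trans (c_s k))// ler_wpM2l//.
    by apply: lerXn2r; rewrite ?nnegrE ?invr_ge0//; lra.
  by rewrite -mulr_sumr mulrC ler_wpM2r// sum_half_powers_le2.
Qed.

Lemma uniformly_K_monotone_IntK : uniformly_K_monotone X -> IntK XX X.
Proof.
move=> [Xmono [C0 C0P]]; pose C := Num.max 1 C0.
have C_gt0 : 0 < C by rewrite lt_max ltr01.
have CP x z : dom (Sigma XX) x -> (forall t, 0 < t -> K t x <= K t (emb X z)) ->
    exists2 w, emb X w = x & qnorm w <= C * qnorm z.
  move=> Sx xz; have Xz := image_dom (emb X) z.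
  have [w _ wE] := Xmono _ _ Xz Sx xz; exists w => //.
  have := C0P _ _ Xz Sx xz; rewrite -wE !nrmE => /le_trans; apply.
  by rewrite ler_wpM2r ?qnorm_ge0// le_max lexx orbT.
have [pos|Npos] := pselect (exists z, 0 < K 1 (emb X z)).
  apply: (majorants_IntK (K_majorants pos)).
  - move=> z t s t0 /andP[ts s2]; have Sz := intermediate_Sigma z.
    have h := K_scale_homo t0 ts Sz; have Kt := K_ge0 (ltW t0) Sz.
    by rewrite -(ler_pM2l t0) (le_trans h)// [leRHS]mulrCA mulrA ler_wpM2r.
  - by exists 1 => // z; exists z; rewrite ?mul1r.
  - exists (C * 2); first exact: mulr_gt0.
    move=> z x Sx xz; have [|w wE wz] := CP x (2 *: z) Sx.
      move=> t t0; rewrite linearZ/= KZ ?(ltW t0)// ?gtr0_norm ?xz//.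
      exact: intermediate_Sigma.
    by exists w => //; rewrite -mulrA; rewrite qnormZ gtr0_norm in wz.
(* here [K t x = 0] whenever [K t x] is dominated by [min(1, t)] *)
have X0 z : K 1 (emb X z) <= 0.
  by rewrite leNgt; apply/negP => z0; apply: Npos; exists z.
apply: (majorants_IntK min_majorants).
- move=> c t s t0 /andP[ts s2]; rewrite mulrCA ler_wpM2l//.
  rewrite -[X in _ <= X * _]gtr0_norm// minr_pMr// gtr0_norm//.
  rewrite le_min mulr1; apply/andP; split.
    by rewrite ge_min; apply/orP; left; lra.
  by rewrite ge_min s2 orbT.
- exists 1 => // z; exists 0; first by rewrite normr0 mul1r qnorm_ge0.
  by move=> t t0; rewrite normr0 mul0r (K_eq0 (intermediate_Sigma z))// X0.
- exists C => // c x Sx xc.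
  have x0 : K 1 x <= 0.
    apply: (K_min_bounded (c := 2 * `|c|)) => // t t0.
    by rewrite -mulrA xc.
  have [|w wE w0] := CP x 0 Sx.
    move=> t t0; rewrite (K_eq0 Sx)// K_ge0 ?(ltW t0)//.
    exact: intermediate_Sigma.
  by exists w => //; rewrite (le_trans w0)// qnorm0 mulr0 mulr_ge0// ltW.
Qed.

End IntK.

Theorem theorem7p5 (R : realType) (p : R) (XX : qblCouple R)
    (hp0 : 0 < p) (hp1 : p < 1) (hXX : p_convex_couple XX p) :
  (forall X : intermediate XX, K_monotone X ->
     (exists q : R, [/\ 0 < q, q <= p & Kpq_monotone p q X]) /\ IntK XX X) /\
  (IntKM XX = IntK XX) /\
  (IntK XX =
     \bigcup_(rq in [set rq : R * R | [/\ 0 < rq.2, rq.2 <= rq.1 & rq.1 <= 1]])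
        IntKM_pq XX rq.1 rq.2).
Proof.
split; [|split].
- move=> X /K_monotone_uniformly Xunif; split; last first.
    exact: uniformly_K_monotone_IntK.
  exact: uniformly_K_monotone_Kpq.
- apply/seteqP; split=> X; first exact: uniformly_K_monotone_IntK.
  exact: IntK_uniformly_K_monotone.
- apply/seteqP; split=> X.
    move=> /IntK_uniformly_K_monotone/(uniformly_K_monotone_Kpq hp0)[q [q0 qp Xpq]].
    by exists (p, q) => //; split=> //; exact: ltW.
  move=> [[r q] /= [q0 qr _] Xrq]; apply: uniformly_K_monotone_IntK.
  exact: Kpq_uniformly_K_monotone (lt_le_trans q0 qr) q0 Xrq.
Qed.
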